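(* Let $\alpha\ge 1$. For every $s>0$ there exist $N_0>1$ and $b>1$ such that, with $N_k=N_0^{b^k}$ for $k\ge 0$, there exist initial data $X^0\in\mathcal C^\infty$ with $X^0_k>0$ for all $k\ge 0$ for which the solution $X$ of the inviscid unforced Obukhov model $$X_k'=N_{k-1}^\alpha X_{k-1}X_k-N_k^\alpha X_{k+1}^2,\qquad k\ge 0,\qquad X_{-1}\equiv 0,$$ with $X(0)=X^0$ exhibits finite-time blow-up, i.e. its maximal time of existence satisfies $T_*<\infty$, and moreover $X$ becomes unbounded in $\mathcal C^s$, i.e. $\sup_{0\le t<T_*}\|X(t)\|_s=\infty$.
   Context: Given the increasing sequence of frequency scales $N_k=N_0^{b^k}$ ($k\ge 0$, $N_0>1$, $b>1$), define for $s\in\mathbb R$ the Banach space $\mathcal C^s=\{X:\mathbb N\to\mathbb R:\ \|X\|_s<\infty\}$, where $\mathbb N=\{0,1,2,\dots\}$ and $\|X\|_s:=\sup_{k\ge 0}N_k^s|X_k|$. Define the Fréchet space $\mathcal C^\infty:=\bigcap_{s>0}\mathcal C^s$. In the system, the term containing $X_{-1}$ is zero for $k=0$. For $X^0\in\mathcal C^\infty$ there is a unique local solution $X\in\bigcap_{\sigma>0}C_t([0,T);\mathcal C^\sigma)$ for some $T>0$ with $X(0)=X^0$, and there is a maximal time of existence $T_*\in(0,\infty]$ of the solution in this class. Finite-time blow-up means $T_*<\infty$. *)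

(* Defs.v *)
From mathcomp Require Import all_boot all_order all_algebra.
From mathcomp Require Import all_classical all_reals all_analysis.

Set Implicit Arguments.
Unset Strict Implicit.
Unset Printing Implicit Defensive.

Import Order.TTheory GRing.Theory Num.Theory.
Import numFieldNormedType.Exports.

Local Open Scope classical_set_scope.
Local Open Scope ring_scope.

Section Obukhov.
Variable R : realType.

Definition freq (N0 b : R) (k : nat) : R := N0 `^ (b ^+ k).

(* The weighted sup norm takes values in \bar R, so that it is defined on all
   sequences and X lies in C^s exactly when its norm is finite. *)
Definition snorm (N : nat -> R) (s : R) (X : nat -> R) : \bar R :=
  ereal_sup (range (fun k => (N k `^ s * `|X k|)%:E)).

Definition Cs (N : nat -> R) (s : R) : set (nat -> R) :=
  [set X | (snorm N s X < +oo)%E].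

Definition Coo (N : nat -> R) : set (nat -> R) :=
  \bigcap_(s in [set s : R | 0 < s]) Cs N s.

Definition obukhov (N : nat -> R) (alpha : R) (X : nat -> R) (k : nat) : R :=
  (if k is j.+1 then N j `^ alpha * X j * X k else 0)
  - N k `^ alpha * X k.+1 ^+ 2.

Definition lifespan (T : \bar R) : set R := [set t | 0 <= t /\ (t%:E < T)%E].

(* X \in C([0, T); C^s) for the norm topology of C^s. *)
Definition continuous_in_Cs (N : nat -> R) (s : R) (T : \bar R)
    (X : R -> nat -> R) : Prop :=
  forall t, lifespan T t ->
    Cs N s (X t) /\
    snorm N s (X u \- X t) @[u --> within (lifespan T) (nbhs t)] --> 0%E.

(* Values of X outside [0, T) are irrelevant, so the derivative at t = 0 is
   the right derivative. *)
Definition is_solution (N : nat -> R) (alpha : R) (X0 : nat -> R)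
    (T : \bar R) (X : R -> nat -> R) : Prop :=
  [/\ (0 < T)%E,
      X 0 = X0,
      forall sigma : R, 0 < sigma -> continuous_in_Cs N sigma T X,
      forall (k : nat) (t : R), 0 < t -> (t%:E < T)%E ->
        is_derive t 1 (fun u => X u k) (obukhov N alpha (X t) k) &
      forall k : nat,
        h^-1 * (X h k - X 0 k) @[h --> 0^'+] --> obukhov N alpha (X 0) k].

(* X is the unique solution issued from X0, and T is its maximal time of
   existence. *)
Definition is_maximal_solution (N : nat -> R) (alpha : R) (X0 : nat -> R)
    (T : \bar R) (X : R -> nat -> R) : Prop :=
  is_solution N alpha X0 T X /\
  forall (T' : \bar R) (Y : R -> nat -> R), is_solution N alpha X0 T' Y ->
    (T' <= T)%E /\ (forall t, lifespan T' t -> Y t = X t).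

End Obukhov.

(* Main.v *)
Require Import Defs.
From mathcomp Require Import all_boot all_order all_algebra.
From mathcomp Require Import all_classical all_reals all_analysis.
From mathcomp Require Import ring lra.

Import Order.TTheory GRing.Theory Num.Theory.
Import numFieldNormedType.Exports.

Local Open Scope classical_set_scope.
Local Open Scope ring_scope.

(* Time is reversed: X(t) = x(1 - t), where x solves the backward system
     x_k' = lam_k x_{k+1}^2 - lam_{k-1} x_{k-1} x_k,    lam_k = N_k^alpha,
   with x_k(0) = 2^-(k+1), which is not in C^s for any s > 0.  The backward
   system preserves positivity, its tail energies E_k = sum_{j >= k} x_j^2 are
   nonincreasing, and
     E_{k+2}' = - 2 lam_{k+1} x_{k+1} (E_{k+2} - E_{k+3}).
   As x_{k+1} keeps half of its initial value up to time 1 / (2 lam_k), while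
   E_{k+3} is already negligible from time 1 / (2 lam_{k+1}) on, E_{k+2} drops
   below 2 exp (- lam_k) by time 1 / (2 lam_k).  Hence x(t) lies in C^oo as soon
   as t > 0, and X is a smooth solution from X(0) = x(1) whose C^s norm blows up
   as t -> 1.  The induction runs downwards in k, so x is obtained as a limit of
   systems with finitely many modes, and no uniqueness is needed for it.
   Forward solutions in C^alpha are unique, which makes X maximal. *)

(** * Euler scheme for finitely many modes of the backward system *)

Section BackwardEuler.
Variables (R : realType) (lam c : nat -> R).
Hypothesis lam_ge1 : forall k, 1 <= lam k.
Hypothesis c_ge0 : forall k, 0 <= c k.

(* [mu 0 = 0] encodes X_{-1} = 0: in [bfield] the junk value [x 0.-1 = x 0] is
   multiplied by it. *)
Definition mu (k : nat) : R := if k is j.+1 then lam j else 0.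

Definition bfield (x : nat -> R) (k : nat) : R :=
  lam k * x k.+1 ^+ 2 - mu k * x k.-1 * x k.

Definition euler_step (h : R) (y : nat -> R) (k : nat) : R :=
  y k + h * bfield y k.

(** [j] steps of size [h] from the data cut off to the modes below [n]. The other modes stay zero,
    because a mode is fed only by the next higher one. *)
Definition euler (h : R) (n j : nat) : nat -> R :=
  iter j (euler_step h) (fun k => if (k < n)%N then c k else 0).

(** For states in [0, 1] this bounds the sum of [bfield y i ^+ 2] over the modes below [n], so one
    Euler step disturbs the energy balance by at most [h ^+ 2 * cost n]. Each summand also dominates
    [mu i + lam i], so that smallness of [h * cost n] acts as a step restriction too. *)
Definition cost (n : nat) : R := \sum_(0 <= i < n) (1 + mu i + lam i) ^+ 2.

Definition tail (n : nat) (y : nat -> R) (k : nat) : R :=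
  \sum_(k <= i < n) y i ^+ 2.

Lemma lam_ge0 k : 0 <= lam k.
Proof. exact: le_trans (lam_ge1 k). Qed.

Lemma mu_ge0 k : 0 <= mu k.
Proof. by case: k => [|k] //=; exact: lam_ge0. Qed.

Lemma eulerS h n j : euler h n j.+1 = euler_step h (euler h n j).
Proof. by []. Qed.

Lemma cost_ge0 n : 0 <= cost n.
Proof. by apply: sumr_ge0 => i _; exact: sqr_ge0. Qed.

Lemma le_sqr_cost n k : (k < n)%N -> (1 + mu k + lam k) ^+ 2 <= cost n.
Proof.
move=> kn; rewrite /cost big_mkord (bigD1 (Ordinal kn)) //= lerDl.
by apply: sumr_ge0 => i _; exact: sqr_ge0.
Qed.

Lemma le_cost n k : (k < n)%N -> mu k + lam k <= cost n.
Proof.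
move=> /le_sqr_cost; apply: le_trans.
have := mu_ge0 k; have := lam_ge0 k; nra.
Qed.

Lemma bfield_bound y k : (forall i, 0 <= y i <= 1) ->
  `|bfield y k| <= mu k + lam k.
Proof.
move=> y01; rewrite /bfield.
have /andP[a0 a1] := y01 k.+1; have /andP[b0 b1] := y01 k.-1.
have /andP[d0 d1] := y01 k.
have l0 := lam_ge0 k; have m0 := mu_ge0 k.
have p0 : 0 <= y k.+1 ^+ 2 by exact: sqr_ge0.
have p1 : y k.+1 ^+ 2 <= 1 by rewrite expr_le1.
have q0 : 0 <= y k.-1 * y k by exact: mulr_ge0.
have q1 : y k.-1 * y k <= 1 by rewrite mulr_ile1.
rewrite -mulrA ler_norml; apply/andP; split; nra.
Qed.

Definition speed (k : nat) : R := mu k + lam k.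

(** On the box [0, 1], [speed k] bounds x_k' and [accel k] bounds x_k'': the product rule is applied
    to [bfield], with each derivative replaced by its [speed]. Neither depends on [n] or [h]. *)
Definition accel (k : nat) : R :=
  mu k * (speed k.-1 + speed k) + 2 * lam k * speed k.+1.

Lemma speed_ge0 k : 0 <= speed k.
Proof. by have := mu_ge0 k; have := lam_ge0 k; rewrite /speed; lra. Qed.

Lemma accel_ge0 k : 0 <= accel k.
Proof.
apply: addr_ge0; apply: mulr_ge0; last exact: speed_ge0.
- exact: mu_ge0.
- by apply: addr_ge0; exact: speed_ge0.
- by apply: mulr_ge0 => //; exact: lam_ge0.
Qed.

(** The number [d] stands for an elapsed time, over which mode i moves by at most [d * speed i]. *)
Lemma bfield_lip x y k (d : R) :
  (forall i, 0 <= x i <= 1) -> (forall i, 0 <= y i <= 1) ->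
  (forall i, `|x i - y i| <= d * speed i) ->
  `|bfield x k - bfield y k| <= d * accel k.
Proof.
move=> x01 y01 xy; rewrite /bfield /accel.
have sq : `|x k.+1 ^+ 2 - y k.+1 ^+ 2| <= 2 * (d * speed k.+1).
  rewrite subr_sqr mulrC normrM; apply: ler_pM => //.
  have /andP[a0 a1] := x01 k.+1; have /andP[b0 b1] := y01 k.+1.
  by rewrite ger0_norm; lra.
have pr : `|x k.-1 * x k - y k.-1 * y k| <= d * speed k.-1 + d * speed k.
  have -> : x k.-1 * x k - y k.-1 * y k =
    (x k.-1 - y k.-1) * x k + y k.-1 * (x k - y k) by ring.
  apply: le_trans (ler_normD _ _) _; rewrite !normrM.
  have /andP[a0 a1] := x01 k; have /andP[b0 b1] := y01 k.-1.
  rewrite (ger0_norm a0) (ger0_norm b0); apply: lerD.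
    by apply: le_trans (xy k.-1); rewrite ler_piMr.
  by apply: le_trans (xy k); rewrite ler_piMl.
have -> : lam k * x k.+1 ^+ 2 - mu k * x k.-1 * x k -
  (lam k * y k.+1 ^+ 2 - mu k * y k.-1 * y k) =
  lam k * (x k.+1 ^+ 2 - y k.+1 ^+ 2) - mu k * (x k.-1 * x k - y k.-1 * y k) by ring.
apply: le_trans (ler_normB _ _) _; rewrite !normrM.
rewrite (ger0_norm (lam_ge0 k)) (ger0_norm (mu_ge0 k)).
have := ler_wpM2l (lam_ge0 k) sq; have := ler_wpM2l (mu_ge0 k) pr; lra.
Qed.

(* The energy flux through the bond (i, i+1) enters mode i and leaves mode i+1
   in equal amounts, so the tail sums telescope. *)
Lemma tail_step h n y k : 0 <= h -> (k <= n)%N ->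
  (forall i, 0 <= y i <= 1) -> (forall i, (n <= i)%N -> y i = 0) ->
  tail n (euler_step h y) k <=
    tail n y k - 2 * h * (mu k * y k.-1 * y k ^+ 2) + h ^+ 2 * cost n.
Proof.
move=> h0 kn y01 ysupp.
have flux : \sum_(k <= i < n) y i * bfield y i = - (mu k * y k.-1 * y k ^+ 2).
  (* [u i] is the flux from mode i to mode i-1. The flux at the upper end vanishes because
     [y n = 0]. *)
  pose u i := mu i * y i.-1 * y i ^+ 2.
  rewrite (eq_bigr (fun i => u i.+1 - u i)); last first.
    by move=> i _; rewrite /u /bfield /=; ring.
  by rewrite telescope_sumr// /u (ysupp n)// expr0n /= mulr0 sub0r.
have sqs : \sum_(k <= i < n) bfield y i ^+ 2 <= cost n.
  apply: (@le_trans _ _ (\sum_(k <= i < n) (1 + mu i + lam i) ^+ 2)).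
    apply: ler_sum => i _; rewrite -[leLHS]real_normK ?num_real//.
    apply: lerXn2r; rewrite ?nnegrE ?normr_ge0//.
      by have := mu_ge0 i; have := lam_ge0 i; lra.
    by have := bfield_bound y i y01; lra.
  rewrite /cost (big_cat_nat (leq0n k) kn) /= lerDr.
  by apply: sumr_ge0 => i _; exact: sqr_ge0.
rewrite /tail (eq_bigr (fun i => y i ^+ 2 + (2 * h * (y i * bfield y i) +
    h ^+ 2 * bfield y i ^+ 2))); last first.
  by move=> i _; rewrite /euler_step; ring.
rewrite big_split big_split /= -!mulr_sumr flux.
have := ler_wpM2l (sqr_ge0 h) sqs; lra.
Qed.

Ltac nonneg := do ?[exact: sqr_ge0 | exact: lam_ge0 | exact: mu_ge0
  | exact: cost_ge0 | exact: expR_ge0 | done | exact: ltW | rewrite subr_ge0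
  | apply: mulr_ge0].

(** * A priori bounds for the Euler scheme up to time 2 *)

Section FixedStep.
Variables (h : R) (n : nat).
Hypothesis h_gt0 : 0 < h.
Hypothesis h_small : h * cost n <= 1 / 8.
Hypothesis c_energy : forall m, \sum_(0 <= i < m) c i ^+ 2 <= 1 / 2.

Local Notation y j := (euler h n j).

Lemma mu_small k : (k < n)%N -> h * mu k <= 1 / 8.
Proof.
move=> kn; apply: le_trans h_small; apply: ler_wpM2l; first exact: ltW.
by have := le_cost n k kn; have := lam_ge0 k; lra.
Qed.

Lemma lam_small k : (k < n)%N -> h * lam k <= 1 / 8.
Proof.
move=> kn; apply: le_trans h_small; apply: ler_wpM2l; first exact: ltW.
by have := le_cost n k kn; have := mu_ge0 k; lra.
Qed.

(** The claims need each other: positivity of the next step uses y <= 1 and the step restriction,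
    while y <= 1 comes from the total energy. That energy starts below 1/2 and gains at most (j h)
    (h cost n) <= 2 / 8 up to time 2, so it stays below 1. *)
Lemma euler_invariant j : j%:R * h <= 2 ->
  [/\ forall i, 0 <= y j i <= 1, forall i, (n <= i)%N -> y j i = 0 &
      tail n (y j) 0 <= 1 / 2 + j%:R * (h ^+ 2 * cost n)].
Proof.
have C0 := cost_ge0 n.
have box z : (forall i, 0 <= z i) -> (forall i, (n <= i)%N -> z i = 0) ->
    tail n z 0 <= 1 -> forall i, 0 <= z i <= 1.
  move=> z0 zs zE i; rewrite z0 /=; have [ni|ni] := leqP n i; first by rewrite zs.
  rewrite -(@expr_le1 _ 2)//; apply: le_trans zE.
  rewrite /tail big_mkord (bigD1 (Ordinal ni)) //= lerDl.
  by apply: sumr_ge0 => ? _; exact: sqr_ge0.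
elim: j => [|j IH] jh.
  have y0 i : 0 <= y 0 i by rewrite /euler /=; case: ifP.
  have ys i : (n <= i)%N -> y 0 i = 0 by rewrite /euler /= ltnNge => ->.
  have E0 : tail n (y 0) 0 <= 1 / 2.
    apply: le_trans (c_energy n); rewrite le_eqVlt; apply/orP; left; apply/eqP.
    by rewrite /tail !big_mkord; apply: eq_bigr => i _; rewrite /euler /= ltn_ord.
  split => //; last by rewrite mul0r addr0.
  by apply: box => //; apply: le_trans E0 _; lra.
have jh' : j%:R * h <= 2 by apply: le_trans jh; rewrite ler_pM2r// ler_nat.
have [y01 ys yE] := IH jh'.
have ys' i : (n <= i)%N -> y j.+1 i = 0.
  move=> ni; rewrite eulerS /euler_step /bfield (ys i)// (ys i.+1) ?leqW//.
  by rewrite expr0n /=; ring.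
have y0' i : 0 <= y j.+1 i.
  have [/ys' ->//|ni] := leqP n i.
  have hm := mu_small i ni.
  rewrite eulerS /euler_step /bfield.
  have /andP[a0 a1] := y01 i.-1; have /andP[b0 b1] := y01 i.
  have p0 : 0 <= h * (lam i * y j i.+1 ^+ 2).
    by apply: mulr_ge0 (ltW h_gt0) (mulr_ge0 (lam_ge0 _) (sqr_ge0 _)).
  have q : h * mu i * y j i.-1 <= 1.
    have : 0 <= h * mu i by exact: mulr_ge0 (ltW h_gt0) (mu_ge0 i).
    nra.
  have -> : y j i + h * (lam i * y j i.+1 ^+ 2 - mu i * y j i.-1 * y j i) =
    h * (lam i * y j i.+1 ^+ 2) + y j i * (1 - h * mu i * y j i.-1) by ring.
  by rewrite addr_ge0// mulr_ge0// subr_ge0.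
have yE' : tail n (y j.+1) 0 <= 1 / 2 + j.+1%:R * (h ^+ 2 * cost n).
  rewrite eulerS; apply: le_trans (tail_step h n _ 0 (ltW h_gt0) (leq0n n) y01 ys) _.
  by rewrite /= !mul0r mulr0 subr0 -(natr1 j) mulrDl mul1r; lra.
split => //; apply: box => //; apply: le_trans yE' _.
have -> : j.+1%:R * (h ^+ 2 * cost n) = (j.+1%:R * h) * (h * cost n) by ring.
have hC0 : 0 <= h * cost n by exact: mulr_ge0 (ltW h_gt0) C0.
have := ler_wpM2r hC0 jh; move: h_small; move: (j.+1%:R * h * (h * cost n)) (h * cost n) => u v; lra.
Qed.

Lemma euler01 j i : j%:R * h <= 2 -> 0 <= y j i <= 1.
Proof. by move=> /euler_invariant[]. Qed.

(** The gain term is nonnegative and x_{k-1} <= 1, so a step multiplies mode k by at least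
    [1 - h * mu k]. *)
Lemma euler_lower j k : j%:R * h <= 2 -> (k < n)%N ->
  c k * (1 - h * mu k) ^+ j <= y j k.
Proof.
move=> jh kn; have hm := mu_small k kn.
elim: j jh => [|j IH] jh; first by rewrite expr0 mulr1 /euler /= kn.
have jh' : j%:R * h <= 2 by apply: le_trans jh; rewrite ler_pM2r// ler_nat.
have {}IH := IH jh'.
have [y01 _ _] := euler_invariant j jh'.
have /andP[a0 a1] := y01 k.-1; have /andP[b0 b1] := y01 k.
have m0 : 0 <= h * mu k by exact: mulr_ge0 (ltW h_gt0) (mu_ge0 k).
rewrite eulerS /euler_step /bfield exprS mulrCA.
apply: (@le_trans _ _ ((1 - h * mu k) * y j k)).
  by apply: ler_wpM2l => //; lra.
have p0 : 0 <= h * (lam k * y j k.+1 ^+ 2).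
  by apply: mulr_ge0 (ltW h_gt0) (mulr_ge0 (lam_ge0 _) (sqr_ge0 _)).
have : 0 <= h * mu k * y j k * (1 - y j k.-1).
  by apply: mulr_ge0; [exact: mulr_ge0 | rewrite subr_ge0].
lra.
Qed.

(** Discrete form of E_k' = - 2 mu_k x_{k-1} (E_k - E_{k+1}): as long as 2 mu_k x_{k-1} >= a and
    E_{k+1} <= eps, each step contracts E_k - eps by the factor 1 - h a, up to the quadratic error
    of the scheme. *)
Lemma tail_driven k (eps : R) (i0 i : nat) (a : R) :
  (k < n)%N -> 0 <= a -> h * a <= 1 -> (i0 + i)%:R * h <= 2 ->
  (forall j, (i0 <= j < i0 + i)%N -> a <= 2 * mu k * y j k.-1) ->
  (forall j, (i0 <= j < i0 + i)%N -> tail n (y j) k.+1 <= eps) ->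
  tail n (y i0) k <= eps + 1 ->
  tail n (y (i0 + i)%N) k <= eps + (1 - h * a) ^+ i + i%:R * (h ^+ 2 * cost n).
Proof.
move=> kn a0 ha jh drive small init.
have e0 : 0 <= h ^+ 2 * cost n by exact: mulr_ge0 (sqr_ge0 h) (cost_ge0 n).
elim: i jh drive small => [|i IH] jh drive small.
  by rewrite addn0 expr0 mul0r addr0.
have jh' : (i0 + i)%:R * h <= 2.
  by apply: le_trans jh; rewrite ler_pM2r// ler_nat addnS.
have inr j : (i0 <= j < i0 + i)%N -> (i0 <= j < i0 + i.+1)%N.
  by case/andP=> -> /= ji; rewrite addnS ltnS ltnW.
have {}IH := IH jh' (fun j ji => drive j (inr j ji)) (fun j ji => small j (inr j ji)).
have ii : (i0 <= i0 + i < i0 + i.+1)%N by rewrite leq_addr addnS ltnS leqnn.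
have dr := drive _ ii; have sm := small _ ii.
rewrite addnS eulerS; set w := y (i0 + i)%N in IH dr sm *.
have [w01 ws _] := euler_invariant _ jh'; rewrite -/w in w01 ws.
apply: le_trans (tail_step h n w k (ltW h_gt0) (ltnW kn) w01 ws) _.
have tE : tail n w k = w k ^+ 2 + tail n w k.+1 by rewrite /tail big_ltn.
(* The energy lost through the lower end is at least h a w_k^2, and w_k^2 = E_k - E_{k+1} >= E_k -
   eps. *)
have st : h * a * (tail n w k - eps) <= 2 * h * (mu k * w k.-1 * w k ^+ 2).
  apply: (@le_trans _ _ (h * a * w k ^+ 2)).
    by apply: ler_wpM2l; [exact: mulr_ge0 (ltW h_gt0) a0 | lra].
  have -> : 2 * h * (mu k * w k.-1 * w k ^+ 2) = h * (2 * mu k * w k.-1) * w k ^+ 2.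
    by ring.
  by apply: ler_wpM2r; rewrite ?sqr_ge0//; apply: ler_wpM2l => //; exact: ltW.
have ha0 : 0 <= h * a by exact: mulr_ge0 (ltW h_gt0) a0.
have key : (1 - h * a) * (tail n w k - eps) <=
    (1 - h * a) * ((1 - h * a) ^+ i + i%:R * (h ^+ 2 * cost n)).
  by apply: ler_wpM2l; lra.
have ie0 : 0 <= i%:R * (h ^+ 2 * cost n) by rewrite mulr_ge0.
have hai : 0 <= h * a * (i%:R * (h ^+ 2 * cost n)) by rewrite mulr_ge0.
rewrite (exprS _ i) -(natr1 i) [(i%:R + 1) * _]mulrDl mul1r; move: st key hai ie0.
set S := 2 * h * _; set P := (1 - _) ^+ i; set I := i%:R * _.
by move: (h * a) (h ^+ 2 * _) => A e; lra.
Qed.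

Lemma bernoulli (x : R) j : 0 <= x <= 1 -> 1 - j%:R * x <= (1 - x) ^+ j.
Proof.
move=> /andP[x0 x1]; elim: j => [|j IH]; first by rewrite mul0r subr0 expr0.
have := ler_wpM2l (_ : 0 <= 1 - x) IH; rewrite subr_ge0 => /(_ x1).
rewrite (exprS _ j) -(natr1 j); apply: le_trans.
have : 0 <= j%:R * (x * x) by nonneg.
by set u := j%:R; lra.
Qed.

Lemma tail_nincr k i0 i : (k <= n)%N -> (i0 + i)%:R * h <= 2 ->
  tail n (y (i0 + i)%N) k <= tail n (y i0) k + i%:R * (h ^+ 2 * cost n).
Proof.
move=> kn; elim: i => [|i IH] jh; first by rewrite addn0 mul0r addr0.
have jh' : (i0 + i)%:R * h <= 2.
  by apply: le_trans jh; rewrite ler_pM2r// ler_nat addnS.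
have [w01 ws _] := euler_invariant _ jh'.
rewrite addnS eulerS; apply: le_trans (tail_step h n _ k (ltW h_gt0) kn w01 ws) _.
have /andP[a0 _] := w01 k.-1.
have : 0 <= 2 * h * (mu k * y (i0 + i) k.-1 * y (i0 + i) k ^+ 2).
  by nonneg.
by have := IH jh'; rewrite -(natr1 i) [(i%:R + 1) * _]mulrDl mul1r; lra.
Qed.

Lemma c_le1 k : c k <= 1.
Proof.
rewrite -(@expr_le1 _ 2)//; apply: (@le_trans _ _ (1 / 2)); last lra.
apply: le_trans (c_energy k.+1); rewrite big_nat_recr//= lerDr.
by apply: sumr_ge0 => ? _; exact: sqr_ge0.
Qed.

Lemma euler_lipschitz i0 i k : (i0 + i)%:R * h <= 2 ->
  `|y (i0 + i) k - y i0 k| <= i%:R * h * speed k.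
Proof.
elim: i => [|i IH] jh; first by rewrite addn0 subrr normr0 !mul0r.
have jh' : (i0 + i)%:R * h <= 2.
  by apply: le_trans jh; rewrite ler_pM2r// ler_nat addnS.
have [w01 _ _] := euler_invariant _ jh'.
have Fb := bfield_bound _ k w01; rewrite -/(speed k) in Fb.
rewrite addnS eulerS /euler_step addrAC; apply: le_trans (ler_normD _ _) _.
rewrite normrM (gtr0_norm h_gt0) -(natr1 i).
by have := IH jh'; have := ler_wpM2l (ltW h_gt0) Fb; lra.
Qed.

(** After i steps the field has changed by at most i h [accel k]; adding h times these changes stays
    below [accel k] times the squared elapsed time. The bound involves neither [n] nor [h]
    separately, so it survives the limit. *)
Lemma euler_taylor i0 i k : (i0 + i)%:R * h <= 2 ->
  `|y (i0 + i) k - y i0 k - i%:R * h * bfield (y i0) k| <=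
    accel k * (i%:R * h) ^+ 2.
Proof.
elim: i => [|i IH] jh.
  by rewrite addn0 subrr !mul0r subr0 normr0 expr0n mulr0.
have jh' : (i0 + i)%:R * h <= 2.
  by apply: le_trans jh; rewrite ler_pM2r// ler_nat addnS.
have jh0 : i0%:R * h <= 2.
  by apply: le_trans jh; rewrite ler_pM2r// ler_nat leq_addr.
have [w01 _ _] := euler_invariant _ jh'.
have [v01 _ _] := euler_invariant _ jh0.
have dF := bfield_lip _ _ k (i%:R * h) w01 v01 (fun q => euler_lipschitz i0 i q jh').
rewrite addnS eulerS /euler_step.
have -> : y (i0 + i) k + h * bfield (y (i0 + i)) k - y i0 k -
    i.+1%:R * h * bfield (y i0) k =
  (y (i0 + i) k - y i0 k - i%:R * h * bfield (y i0) k) +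
  h * (bfield (y (i0 + i)) k - bfield (y i0) k) by rewrite -(natr1 i); ring.
apply: le_trans (ler_normD _ _) _; rewrite normrM (gtr0_norm h_gt0).
have := IH jh'; have := ler_wpM2l (ltW h_gt0) dF; rewrite -(natr1 i).
have : 0 <= accel k * (i%:R * h ^+ 2 + h ^+ 2).
  by apply: mulr_ge0; [exact: accel_ge0 | apply: addr_ge0; nonneg].
move: (i%:R) => I; nra.
Qed.

(** * Piecewise constant interpolation in time *)

Definition interp (t : R) : nat -> R := y (Num.truncn (t / h)).

Lemma interp_index t : 0 <= t ->
  (Num.truncn (t / h))%:R * h <= t < (Num.truncn (t / h))%:R * h + h.
Proof.
move=> t0; have /truncn_itv : 0 <= t / h by rewrite divr_ge0// ltW.
by rewrite ler_pdivlMr// ltr_pdivrMr// -natr1 mulrDl mul1r.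
Qed.

Lemma interp01 t k : 0 <= t <= 2 -> 0 <= interp t k <= 1.
Proof.
move=> /andP[t0 t2]; apply: euler01; have /andP[le _] := interp_index t t0.
exact: le_trans t2.
Qed.

Lemma interp_taylor s t k : 0 <= s -> s <= t -> t <= 2 ->
  `|interp t k - interp s k| <= (t - s + h) * speed k /\
  `|interp t k - interp s k - (t - s) * bfield (interp s) k| <=
    accel k * (t - s + h) ^+ 2 + h * speed k.
Proof.
move=> s0 st t2; have t0 := le_trans s0 st.
have /andP[p1 p2] := interp_index t t0; have /andP[q1 q2] := interp_index s s0.
have ij : (Num.truncn (s / h) <= Num.truncn (t / h))%N.
  by apply: le_truncn; rewrite ler_pM2r// invr_gt0.
rewrite /interp; move: p1 p2 q1 q2; rewrite -(subnKC ij).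
move: (Num.truncn (s / h)) (_ - _)%N => i0 i p1 p2 q1 q2.
have jh := le_trans p1 t2.
have L := euler_lipschitz i0 i k jh; have T := euler_taylor i0 i k jh.
rewrite natrD mulrDl in p1 p2.
have [w01 _ _] := euler_invariant i0 (le_trans q1 (le_trans st t2)).
have Fb := bfield_bound _ k w01; rewrite -/(speed k) in Fb.
have ih0 : 0 <= i%:R * h by rewrite mulr_ge0// ltW.
split.
  by apply: le_trans L _; apply: ler_wpM2r; [exact: speed_ge0 | lra].
have -> : y (i0 + i) k - y i0 k - (t - s) * bfield (y i0) k =
  (y (i0 + i) k - y i0 k - i%:R * h * bfield (y i0) k) +
  (i%:R * h - (t - s)) * bfield (y i0) k by ring.
apply: le_trans (ler_normD _ _) _; apply: lerD.
  apply: le_trans T _; apply: ler_wpM2l; first exact: accel_ge0.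
  by apply: lerXn2r; rewrite ?nnegrE//; lra.
rewrite normrM; apply: ler_pM => //.
by rewrite ler_norml; apply/andP; split; lra.
Qed.

Lemma interp_lower t k : 0 <= t <= 2 -> (k < n)%N ->
  c k * expR (- (2 * mu k * t)) <= interp t k.
Proof.
move=> /andP[t0 t2] kn; have /andP[p1 p2] := interp_index t t0.
have hm := mu_small k kn.
have hm0 : 0 <= h * mu k by exact: mulr_ge0 (ltW h_gt0) (mu_ge0 k).
apply: le_trans (euler_lower _ k (le_trans p1 t2) kn).
apply: ler_wpM2l => //.
apply: (@le_trans _ _ (expR (- (2 * (h * mu k))) ^+ Num.truncn (t / h))).
  rewrite -expRM_natl ler_expR mulrN lerN2.
  by have := ler_wpM2r (mu_ge0 k) p1; lra.
apply: lerXn2r; rewrite ?nnegrE ?expR_ge0 ?subr_ge0//; first lra.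
(* With u = h mu_k <= 1/8, exp (2 u) (1 - u) >= (1 + 2 u) (1 - u) >= 1; this is where the 2 in the
   exponent comes from. *)
rewrite expRN -[leLHS]mul1r ler_pdivrMr ?expR_gt0//.
have := expR_ge1Dx (2 * (h * mu k)).
have le0 : 0 <= 1 - h * mu k by lra.
move=> /(ler_wpM2l le0); apply: le_trans.
by move: hm hm0; set u := h * mu k => *; nra.
Qed.

(** * Instantaneous decay of the tail energies *)

Section SuperDecay.
Hypothesis lam_growth : forall k, 4 * lam k <= lam k.+1.
Hypothesis c_lower : forall k, 4 * lam k ^+ 2 <= lam k.+1 * c k.+1.

(* Number of steps up to time 1 / (2 * lam k), until when mode k+1 has kept half
   of its initial value. *)
Definition nsteps (k : nat) : nat := Num.truncn (1 / (2 * lam k * h)).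

Lemma nsteps_bounds k :
  (nsteps k)%:R * (2 * lam k * h) <= 1 < (nsteps k).+1%:R * (2 * lam k * h).
Proof.
have l1 := lam_ge1 k.
have p : 0 < 2 * lam k * h by rewrite !mulr_gt0//; lra.
have /truncn_itv : 0 <= 1 / (2 * lam k * h) by rewrite divr_ge0// ltW.
by rewrite ler_pdivlMr// ltr_pdivrMr.
Qed.

Lemma nsteps_le k : (nsteps k.+1 <= nsteps k)%N.
Proof.
have l1 := lam_ge1 k; have l2 := lam_growth k.
apply: le_truncn; rewrite ler_pM2l// lef_pV2 ?posrE ?mulr_gt0//; try lra.
by rewrite ler_pM2r// ler_pM2l//; lra.
Qed.

(** By [bernoulli] the loss factor (1 - h lam_k)^j is at least 1 - j h lam_k, which is at least 1/2
    up to time 1 / (2 lam_k). *)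
Lemma driver_lower k j : (k.+1 < n)%N -> (j < nsteps k)%N -> j%:R * h <= 2 ->
  c k.+1 <= 2 * y j k.+1.
Proof.
move=> kn jk jh; have := euler_lower j k.+1 jh kn.
have hl := lam_small k (ltnW kn).
have hl0 : 0 <= h * lam k by exact: mulr_ge0 (ltW h_gt0) (lam_ge0 k).
have := bernoulli (h * lam k) j; rewrite hl0 /= => /(_ ltac:(lra)) be.
have /andP[up _] := nsteps_bounds k.
have jl : j%:R * (2 * lam k * h) <= 1.
  apply: le_trans up; apply: ler_wpM2r; last by rewrite ler_nat ltnW.
  by nonneg.
have half : 1 / 2 <= (1 - h * lam k) ^+ j.
  apply: le_trans be; move: jl; have -> : j%:R * (2 * lam k * h) = 2 * (j%:R * (h * lam k)).
    by ring.
  by set u := j%:R * (h * lam k); lra.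
by have := ler_wpM2l (c_ge0 k.+1) half; rewrite /=; lra.
Qed.

(** Downward induction on the mode, run on a bound [m] for the number of modes in the tail; an empty
    tail starts it. Between the times 1 / (2 lam_{k+1}) and 1 / (2 lam_k), E_{k+3} is small by
    induction and mode k+1 drives E_{k+2} down; afterwards E_{k+2} does not grow, up to
    discretisation error. Each level adds at most [2 * (h * cost n)] of such error, hence the factor
    [m%:R]. *)
Lemma tail_decay m k j : (n <= k.+2 + m)%N -> (nsteps k <= j)%N ->
  j%:R * h <= 2 ->
  tail n (y j) k.+2 <= 2 * expR (- lam k) + m%:R * (2 * (h * cost n)).
Proof.
have hC0 : 0 <= h * cost n by exact: mulr_ge0 (ltW h_gt0) (cost_ge0 n).
have trivial_tail p q l : (n <= q)%N ->
    tail n (y l) q <= 2 * expR (- lam p) + m%:R * (2 * (h * cost n)) => [nq|].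
  rewrite /tail big_geq//; apply: addr_ge0; first by nonneg.
  by nonneg.
elim: m k j trivial_tail => [|m IH] k j trivial_tail nk kj jh.
  by apply: trivial_tail; rewrite addn0 in nk.
have [/trivial_tail //|kn] := leqP n k.+2.
have {}IH l : (nsteps k.+1 <= l)%N -> l%:R * h <= 2 ->
    tail n (y l) k.+3 <= 2 * expR (- lam k.+1) + m%:R * (2 * (h * cost n)).
  apply: IH; last by rewrite addSnnS.
  move=> p q l' nq; rewrite /tail big_geq//; apply: addr_ge0.
    by nonneg.
  by nonneg.
have l1 := lam_ge1 k; have l2 := lam_growth k; have c2 := c_lower k.
have c0 := c_ge0 k.+1; have c1 := c_le1 k.+1.
have hl := lam_small k (ltnW (ltnW kn)).
have hl' := lam_small k.+1 (ltnW kn).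
(* The contraction rate: by [driver_lower], 2 lam_{k+1} x_{k+1} >= lam_{k+1} c_{k+1} during the
   first phase. *)
pose a := lam k.+1 * c k.+1.
have a0 : 0 <= a by nonneg.
have ha1 : h * a <= 1.
  have : 0 <= h * lam k.+1 * (1 - c k.+1).
    by nonneg.
  by rewrite /a; lra.
have ha0 : 0 <= h * a by exact: mulr_ge0 (ltW h_gt0) a0.
have le2 l : (l <= nsteps k)%N -> l%:R * h <= 2.
  move=> lk; apply: (@le_trans _ _ (j%:R * h)) => //.
  by rewrite ler_pM2r// ler_nat (leq_trans lk).
have jE : (nsteps k.+1 + (nsteps k - nsteps k.+1))%N = nsteps k.
  by rewrite subnKC// nsteps_le.
have phase1 := tail_driven k.+2 (2 * expR (- lam k.+1) + m%:R * (2 * (h * cost n)))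
  (nsteps k.+1) (nsteps k - nsteps k.+1) a kn a0 ha1.
rewrite jE in phase1.
have {}phase1 := phase1 (le2 _ (leqnn _)).
have {}phase1 : tail n (y (nsteps k)) k.+2 <=
   2 * expR (- lam k.+1) + m%:R * (2 * (h * cost n)) +
   (1 - h * a) ^+ (nsteps k - nsteps k.+1) +
   (nsteps k - nsteps k.+1)%:R * (h ^+ 2 * cost n).
  apply: phase1.
  - move=> l /andP[_ lk]; have := driver_lower k l (ltnW kn) lk (le2 l (ltnW lk)).
    by move=> /(ler_wpM2l (lam_ge0 k.+1)); rewrite /a /=; lra.
  - by move=> l /andP[kl lk]; apply: IH => //; apply: le2; exact: ltnW.
  - have lh := le2 _ (nsteps_le k).
    have [_ _ E0] := euler_invariant _ lh.
    have E1 : tail n (y (nsteps k.+1)) k.+2 <= tail n (y (nsteps k.+1)) 0.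
      rewrite /tail (big_cat_nat (leq0n k.+2) (ltnW kn)) /= lerDr.
      by apply: sumr_ge0 => ? _; exact: sqr_ge0.
    have : (nsteps k.+1)%:R * (h ^+ 2 * cost n) <= 2 * (h * cost n).
      have -> : (nsteps k.+1)%:R * (h ^+ 2 * cost n) =
        (nsteps k.+1)%:R * h * (h * cost n) by ring.
      exact: ler_wpM2r.
    have := expR_ge0 (- lam k.+1).
    have : 0 <= m%:R * (2 * (h * cost n)) by nonneg.
    move: h_small E0 E1; move: (m%:R * (2 * (h * cost n))) ((nsteps k.+1)%:R * (h ^+ 2 * cost n)) (h * cost n) => u v w.
    by lra.
(* The first phase lasts at least 1 / (4 lam_k): in units of 1 / lam_k it ends after 1/2 - 1/8,
   where 1/8 bounds the rounding h lam_k, and starts before 1/8 by [lam_growth]. As a >= 4 lam_k^2,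
   the exponent is at least lam_k. *)
have decay : (1 - h * a) ^+ (nsteps k - nsteps k.+1) <= expR (- lam k).
  apply: (@le_trans _ _ (expR (- (h * a)) ^+ (nsteps k - nsteps k.+1))).
    apply: lerXn2r; rewrite ?nnegrE ?expR_ge0 ?subr_ge0//.
    by have := expR_ge1Dx (- (h * a)).
  rewrite -expRM_natl ler_expR mulrN lerN2 natrB ?nsteps_le//.
  have /andP[_ lo] := nsteps_bounds k; have /andP[up _] := nsteps_bounds k.+1.
  rewrite -(natr1 (nsteps k)) in lo.
  move: lo up; move: (nsteps k)%:R ((nsteps k.+1)%:R : R) (ler0n R (nsteps k.+1)).
  move=> u v v0 lo up.
  have up' : v * (8 * lam k * h) <= 1.
    apply: le_trans up; apply: ler_wpM2l => //; apply: ler_wpM2r; first exact: ltW.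
    by lra.
  have : 1 / 4 <= (u - v) * h * lam k by lra.
  move=> /(ler_wpM2l a0); rewrite -/a in c2 => q.
  rewrite -(@ler_pM2r _ (lam k)); last by lra.
  by apply: (@le_trans _ _ (a * (1 / 4))); lra.
have two_e : 2 * expR (- lam k.+1) <= expR (- lam k).
  have -> : - lam k = - lam k.+1 + (lam k.+1 - lam k) by ring.
  rewrite expRD [leRHS]mulrC; apply: ler_wpM2r; first exact: expR_ge0.
  by have := expR_ge1Dx (lam k.+1 - lam k); lra.
have := tail_nincr k.+2 (nsteps k) (j - nsteps k) (ltnW kn).
rewrite subnKC// => /(_ jh) phase2; apply: le_trans phase2 _.
(* Both phases together take at most j steps, so their error uses up exactly the increment from [m]
   to [m.+1]. *)
have total : ((nsteps k - nsteps k.+1)%:R + (j - nsteps k)%:R) * (h ^+ 2 * cost n)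
    <= 2 * (h * cost n).
  have -> : forall u : R, u * (h ^+ 2 * cost n) = u * h * (h * cost n).
    by move=> u; ring.
  apply: ler_wpM2r => //; apply: le_trans jh; rewrite ler_pM2r// -natrD ler_nat.
  have := nsteps_le k; move: (nsteps k) (nsteps k.+1) kj => p q pj qp.
  by rewrite addnC addnBA// subnK// leq_subr.
rewrite -(natr1 m); move: phase1 decay total.
move: (m%:R) (h ^+ 2 * cost n) (h * cost n) => M e u.
by move: ((nsteps k - _)%:R) ((j - _)%:R) ((1 - _) ^+ _) => p q r; lra.
Qed.

Lemma interp_decay t k : 0 <= t <= 2 -> 1 / 2 <= t * lam k ->
  interp t k.+2 ^+ 2 <= 2 * expR (- lam k) + n%:R * (2 * (h * cost n)).
Proof.
move=> /andP[t0 t2] tk; have /andP[p1 p2] := interp_index t t0.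
have jh := le_trans p1 t2.
apply: le_trans (tail_decay n k _ _ _ jh); first last.
- apply: le_truncn; have l0 : 0 < lam k by apply: lt_le_trans (lam_ge1 k).
  rewrite ler_pdivrMr ?mulr_gt0//.
  have -> : t / h * (2 * lam k * h) = 2 * (t * lam k).
    by field; rewrite lt0r_neq0.
  by lra.
- by rewrite leq_addl.
rewrite /interp; have [nk|kn] := leqP n k.+2.
  have [_ -> // _] := euler_invariant _ jh.
  by rewrite expr0n /=; apply: sumr_ge0 => ? _; exact: sqr_ge0.
rewrite /tail big_ltn// lerDl.
by apply: sumr_ge0 => ? _; exact: sqr_ge0.
Qed.

End SuperDecay.

End FixedStep.
End BackwardEuler.

(** * Rough solutions of the backward system *)

Section UltraLimit.
Variable R : realType.

(** The image of an ultrafilter in the compact [0, 1] has a cluster point and converges to it. One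
    ultrafilter serves all indices, even uncountably many; outside [D] the limit is a default
    value. *)
Lemma ultra_limit (I : Type) (D : set I) (z : nat -> I -> R) :
  (forall n i, D i -> 0 <= z n i <= 1) ->
  exists (U : set_system nat) (x : I -> R),
    [/\ ProperFilter U, \oo `<=` U &
        forall i, D i -> z n i @[n --> U] --> x i].
Proof.
move=> z01; have [U [UU oU]] := ultraFilterLemma eventually_filter.
have lim i : exists l : R, D i -> z n i @[n --> U] --> l.
  have [Di|nDi] := pselect (D i); last by exists 0.
  have [|l [_ cl]] := @segment_compact R 0 1 (z n i @[n --> U]) _.
    by apply: (@filterE _ U) => n /=; rewrite in_itv /=; exact: z01.
  exists l => _ A Al; have [//|UA] := in_ultra_setVsetC (z ^~ i @^-1` A) UU.
  by have [w [/= nAw Aw]] := cl (~` A) A UA Al.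
have [x xP] := choice lim.
by exists U, x; split => //; exact: ultra_proper.
Qed.

End UltraLimit.

(** * Passage to the limit in the Euler scheme *)

Section BackwardSolution.
Variables (R : realType) (lam c : nat -> R).
Hypothesis lam_ge1 : forall k, 1 <= lam k.
Hypothesis c_ge0 : forall k, 0 <= c k.
Hypothesis c_energy : forall m, \sum_(0 <= i < m) c i ^+ 2 <= 1 / 2.
Hypothesis lam_growth : forall k, 4 * lam k <= lam k.+1.
Hypothesis c_lower : forall k, 4 * lam k ^+ 2 <= lam k.+1 * c k.+1.

Local Notation F := (bfield R lam).

(* Limits along an ultrafilter replace the extraction of a subsequence: the
   second-order Taylor bounds are pointwise and pass to the limit. *)
Lemma backward_solution : exists x : R -> nat -> R,
  [/\ forall t k, 0 <= t <= 2 -> 0 <= x t k <= 1,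
      forall t k, 0 <= t <= 2 -> c k * expR (- (2 * mu R lam k * t)) <= x t k,
      forall t k, 0 <= t <= 2 -> 1 / 2 <= t * lam k ->
        x t k.+2 ^+ 2 <= 2 * expR (- lam k) &
      forall s t k, 0 <= s -> s <= t -> t <= 2 ->
        `|x t k - x s k| <= (t - s) * speed R lam k /\
        `|x t k - x s k - (t - s) * F (x s) k| <= accel R lam k * (t - s) ^+ 2].
Proof.
pose C n := cost R lam n.
have C0 n : 0 <= C n by exact: cost_ge0.
(* The division by 8 (1 + C n) gives the step restriction. The square makes the decay error n (2 h_n
   C_n) at most [harmonic n], hence vanish in the limit despite the factor n. *)
pose h n := harmonic n ^+ 2 / (8 * (1 + C n)).
have d0 n : 0 < 8 * (1 + C n) by have := C0 n; lra.
have e0 n : 0 < @harmonic R n by rewrite invr_gt0.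
have e1 n : @harmonic R n <= 1 by rewrite invf_le1 ?ler1n.
have h0 n : 0 < h n by rewrite divr_gt0// exprn_gt0.
have hC n : h n * C n <= 1 / 8 * harmonic n ^+ 2.
  rewrite /h mulrAC ler_pdivrMr//.
  by have := sqr_ge0 (@harmonic R n); nra.
have hle n : h n <= harmonic n.
  rewrite /h ler_pdivrMr//; have := e0 n; have := e1 n; have := C0 n.
  by move: (harmonic n) (C n) => e u; nra.
have hsmall n : h n * cost R lam n <= 1 / 8.
  apply: le_trans (hC n) _; have := e0 n; have := e1 n.
  by move: (harmonic n) => e; nra.
(* Times and modes form one index set, so that a single ultrafilter gives all limits. *)
pose z n (i : R * nat) := interp R lam c (h n) n i.1 i.2.
pose D := [set i : R * nat | 0 <= i.1 <= 2].
have z01 n i : D i -> 0 <= z n i <= 1.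
  by move=> Di; apply: interp01.
have [U [x [PU oU xP]]] := ultra_limit R _ D z z01.
have hcvg : h n @[n --> U] --> (0 : R).
  apply: cvg_trans (_ : h n @[n --> \oo] --> (0 : R)).
    by move=> A; exact: oU.
  apply: (squeeze_cvgr _ (cvg_cst 0) cvg_harmonic).
  by apply: nearW => n; rewrite hle ltW.
have ecvg : @harmonic R n @[n --> U] --> (0 : R).
  apply: cvg_trans (_ : harmonic n @[n --> \oo] --> (0 : R)).
    by move=> A; exact: oU.
  exact: cvg_harmonic.
have eventually k : \forall n \near U, (k < n)%N.
  by apply: oU; exact: nbhs_infty_gt.
have cvx t k : 0 <= t <= 2 -> z n (t, k) @[n --> U] --> x (t, k).
  by move=> t02; apply: xP.
have cvsq (u : nat -> R) (l : R) :
    u n @[n --> U] --> l -> u n ^+ 2 @[n --> U] --> l ^+ 2.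
  move=> ul; rewrite expr2 (_ : (fun n => u n ^+ 2) = (fun n => u n * u n)).
    exact: (cvgM ul ul).
  by apply/funext => n; rewrite expr2.
have le_limit (f g : nat -> R) (l l' : R) : f n @[n --> U] --> l ->
    g n @[n --> U] --> l' -> (\forall n \near U, f n <= g n) -> l <= l'.
  by move=> fl gl; apply: ler_cvg_to.
exists (fun t k => x (t, k)); split.
- move=> t k t02; apply/andP; split.
    apply: (le_limit (fun=> 0) (fun n => z n (t, k)) _ _ (cvg_cst _) (cvx t k t02)).
    by apply: nearW => n; have /andP[] := z01 n (t, k) t02.
  apply: (le_limit (fun n => z n (t, k)) (fun=> 1) _ _ (cvx t k t02) (cvg_cst _)).
  by apply: nearW => n; have /andP[] := z01 n (t, k) t02.
- move=> t k t02; apply: (le_limit (fun=> _) (fun n => z n (t, k)) _ _ (cvg_cst _) (cvx t k t02)).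
  near=> n; apply: interp_lower => //; near: n; exact: eventually.
- move=> t k t02 tk.
  have -> : 2 * expR (- lam k) = 2 * expR (- lam k) + 0 by rewrite addr0.
  apply: (le_limit (fun n => z n (t, k.+2) ^+ 2)
     (fun n => 2 * expR (- lam k) + harmonic n)).
  + exact: (cvsq _ _ (cvx t k.+2 t02)).
  + by apply: cvgD; [exact: cvg_cst | exact: ecvg].
  + apply: nearW => n; have dec := interp_decay R lam c lam_ge1 c_ge0 (h n) n (h0 n) (hsmall n)
      c_energy lam_growth c_lower t k t02 tk.
    apply: le_trans dec _.
    rewrite lerD2l; apply: (@le_trans _ _ (n%:R * (2 * (1 / 8 * harmonic n ^+ 2)))).
      by apply: ler_wpM2l => //; have := hC n; rewrite /C; lra.
    have nn : n%:R * @harmonic R n <= 1.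
      by rewrite ler_pdivrMr// mul1r ler_nat.
    have := ler_wpM2r (ltW (e0 n)) nn; have := e0 n.
    by move: (n%:R) (harmonic n) => m e; nra.
move=> s t k s0 st t2.
have t02 : 0 <= t <= 2 by rewrite t2 andbT; exact: le_trans st.
have s02 : 0 <= s <= 2 by rewrite s0 /=; exact: le_trans t2.
have tay n := interp_taylor R lam c lam_ge1 c_ge0 (h n) n (h0 n) (hsmall n)
  c_energy s t k s0 st t2.
have th : t - s + h n @[n --> U] --> t - s.
  by rewrite -[t - s in X in _ --> X]addr0; apply: cvgD => //; exact: cvg_cst.
have cst (a : R) : (fun _ : nat => a) @ U --> a by exact: cvg_cst.
split.
  apply: (le_limit (fun n => `|z n (t, k) - z n (s, k)|)
     (fun n => (t - s + h n) * speed R lam k)).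
  - by apply: cvg_norm; apply: cvgB; exact: cvx.
  - exact: cvgM.
  - by apply: nearW => n; have [] := tay n.
apply: (le_limit
  (fun n => `|z n (t, k) - z n (s, k) - (t - s) * F (fun j => z n (s, j)) k|)
  (fun n => accel R lam k * (t - s + h n) ^+ 2 + h n * speed R lam k)).
- apply: cvg_norm; apply: cvgB; first by apply: cvgB; exact: cvx.
  apply: cvgM => //; rewrite /bfield; apply: cvgB.
    by apply: cvgM => //; apply: cvsq; exact: cvx.
  by apply: cvgM; [apply: cvgM => //|]; exact: cvx.
- rewrite -[accel R lam k * _ in X in _ --> X]addr0 -(mul0r (speed R lam k)).
  by apply: cvgD; [apply: cvgM => //; exact: cvsq | exact: cvgM].
- by apply: nearW => n; have [] := tay n.
Unshelve. all: by end_near. Qed.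

End BackwardSolution.

(** * Uniqueness of forward solutions *)

Section Calculus.
Variable R : realType.

Lemma taylor_derivable (f : R -> R) (t d K e : R) : 0 < e ->
  (forall u, `|u| < e -> `|f (t + u) - f t - u * d| <= K * u ^+ 2) ->
  h^-1 * (f (t + h) - f t) @[h --> 0^'] --> d.
Proof.
move=> e0 tay; apply/subr_cvg0.
apply: (@cvg_to_0_linear _ _ K e) => // r /andP[r0 re].
have rn0 : r != 0 by rewrite -normr_gt0.
have -> : r^-1 * (f (t + r) - f t) - d = r^-1 * (f (t + r) - f t - r * d).
  by field.
rewrite normrM normfV ler_pdivrMl//.
by rewrite mulrCA -expr2 real_normK ?num_real// tay.
Qed.

Lemma taylor_is_derive (f : R -> R) (t d K e : R) : 0 < e ->
  (forall u, `|u| < e -> `|f (t + u) - f t - u * d| <= K * u ^+ 2) ->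
  is_derive t 1 f d.
Proof.
move=> e0 /(taylor_derivable _ _ _ _ _ e0) lim.
have {}lim : h^-1 *: ((f \o shift t) (h *: (1 : R)) - f t) @[h --> 0^'] --> d.
  apply: cvg_trans lim; apply: near_eq_cvg; apply: nearW => h /=.
  by rewrite /= -[h *: 1]/(h * 1) mulr1 (addrC t).
by apply: DeriveDef; [apply/cvg_ex; exists d | exact: cvg_lim].
Qed.

Lemma increment_le (f df : R -> R) (a b L : R) : a <= b ->
  (forall u, a < u < b -> is_derive u 1 f (df u)) ->
  {within `[a, b], continuous f} ->
  (forall u, a < u < b -> `|df u| <= L) -> `|f b - f a| <= L * (b - a).
Proof.
move=> ab fd fc dfL; move: ab; rewrite le_eqVlt => /predU1P[<-|ab].
  by rewrite !subrr normr0 mulr0.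
have [c cab ->] := MVT ab (fun u uab => fd u uab) fc.
rewrite normrM (gtr0_norm (_ : 0 < b - a)) ?subr_gt0//.
by apply: ler_wpM2r; [rewrite subr_ge0 ltW | exact: dfL].
Qed.

(** For either sign s, A exp (kappa u) - s f(u) has nonnegative derivative on ]0, t[; the mean value
    theorem thus replaces integration of the bound on f'. *)
Lemma increment_exp (f df : R -> R) (t A kappa : R) : 0 <= t -> 0 <= A ->
  (forall u, 0 < u < t -> is_derive u 1 f (df u)) ->
  {within `[0, t], continuous f} ->
  (forall u, 0 < u < t -> `|df u| <= kappa * A * expR (kappa * u)) ->
  `|f t - f 0| <= A * expR (kappa * t).
Proof.
move=> t0 A0 fd fc dfA.
move: t0; rewrite le_eqVlt => /predU1P[<-|t0].
  by rewrite subrr normr0 mulr_ge0// expR_ge0.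
have ed (u : R) : is_derive u 1 (fun v : R => expR (kappa * v))
    (expR (kappa * u) * kappa).
  apply: (@is_derive1_comp _ expR (fun v => kappa * v)).
  have := is_deriveZ kappa (is_derive_id u (1 : R)).
  by rewrite -[kappa *: 1]/(kappa * 1) mulr1.
suff main (s : R) : `|s| = 1 -> s * (f t - f 0) <= A * expR (kappa * t).
  by rewrite ler_norml; have := main 1; have := main (-1);
    rewrite normrN normr1 => /(_ erefl) ? /(_ erefl) ?; apply/andP; split; lra.
move=> s1.
pose g u := A * expR (kappa * u) - s * f u.
have gd u : 0 < u < t ->
    is_derive u 1 g (A * (expR (kappa * u) * kappa) - s * df u).
  move=> ut.
  have d1 : is_derive u 1 (fun v => A * expR (kappa * v))
    (A * (expR (kappa * u) * kappa)) := is_deriveZ A (ed u).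
  have d2 : is_derive u 1 (fun v => s * f v) (s * df u) := is_deriveZ s (fd u ut).
  exact: (is_deriveB d1 d2).
have gc : {within `[0, t], continuous g}.
  move=> u; apply: cvgB.
    apply: cvgM; first exact: cvg_cst.
    apply: continuous_subspaceT => v.
    by apply: differentiable_continuous; apply/derivable1_diffP; case: (ed v).
  by apply: cvgM; [exact: cvg_cst | exact: fc].
have [c cab E] := MVT t0 gd gc.
have : 0 <= g t - g 0.
  rewrite E subr0; apply: mulr_ge0; last exact: ltW.
  have := dfA c cab; have := ler_norm (s * df c); rewrite normrM s1 mul1r.
  by lra.
by rewrite /g mulr0 expR0; lra.
Qed.

End Calculus.

(** * Continuity and local boundedness in the weighted spaces *)

Section SolutionSpace.
Variables (R : realType) (N : nat -> R).
Hypothesis N_gt0 : forall k, 0 < N k.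

Lemma snorm_leP s (X : nat -> R) M :
  (snorm N s X <= M%:E)%E <-> forall k, N k `^ s * `|X k| <= M.
Proof.
split=> [le k|le].
  by rewrite -lee_fin; apply: le_trans le; apply: ereal_sup_ubound; exists k.
by apply: ge_ereal_sup => _ [k _ <-]; rewrite lee_fin.
Qed.

Lemma snorm_ge0 s (X : nat -> R) : (0 <= snorm N s X)%E.
Proof.
apply: le_trans (_ : (N 0 `^ s * `|X 0%N|)%:E <= _)%E.
  by rewrite lee_fin mulr_ge0// powR_ge0.
by apply: ereal_sup_ubound; exists 0%N.
Qed.

Lemma Cs_snormE s (X : nat -> R) : Cs N s X ->
  snorm N s X = (fine (snorm N s X))%:E.
Proof. by move=> Xs; rewrite fineK// ge0_fin_numE// snorm_ge0. Qed.

Variables (s : R) (T : \bar R) (X : R -> nat -> R).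
Hypothesis X_cont : continuous_in_Cs N s T X.

Lemma continuous_in_Cs_near t e : lifespan T t -> 0 < e ->
  \forall u \near within (lifespan T) (nbhs t),
    forall k, N k `^ s * `|X u k - X t k| <= e.
Proof.
move=> tT e0; have [_ /fine_cvgP[fin /cvgr0Pnorm_lt/(_ _ e0) lt]] := X_cont t tT.
near=> u; apply/snorm_leP.
have uf : snorm N s (X u \- X t) \is a fin_num by near: u.
rewrite -(fineK uf) lee_fin; apply: le_trans (ler_norm _) _; apply: ltW.
by near: u.
Unshelve. all: by end_near. Qed.

Lemma continuous_in_Cs_comp t k : lifespan T t ->
  X u k @[u --> within (lifespan T) (nbhs t)] --> X t k.
Proof.
move=> tT; apply/cvgrPdist_le => e e0.
have w0 : 0 < N k `^ s by exact: powR_gt0.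
have := continuous_in_Cs_near t (N k `^ s * e) tT (mulr_gt0 w0 e0).
by apply: filterS => u /(_ k); rewrite ler_pM2l// distrC.
Qed.

Lemma lifespan_itv t : lifespan T t -> `[0, t] `<=` lifespan T.
Proof.
move=> [t0 tT] u /=; rewrite in_itv /= => /andP[u0 ut]; split => //.
by apply: le_lt_trans tT; rewrite lee_fin.
Qed.

Lemma continuous_in_Cs_itv t k : lifespan T t ->
  {within `[0, t], continuous (X ^~ k)}.
Proof.
move=> tT; apply/subspace_continuousP => u ut.
apply: cvg_trans (continuous_in_Cs_comp u k (lifespan_itv t tT u ut)).
apply: cvg_app; apply: within_subset; exact: lifespan_itv.
Qed.

(** By the triangle inequality the norm of X(u) is continuous in u, so it attains a maximum on the
    compact [0, t]. *)
Lemma continuous_in_Cs_bounded t : lifespan T t ->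
  exists M, forall u k, 0 <= u <= t -> N k `^ s * `|X u k| <= M.
Proof.
move=> tT; have [t0 _] := tT.
pose f u := fine (snorm N s (X u)).
have fP u : lifespan T u -> snorm N s (X u) = (f u)%:E.
  by move=> uT; apply: Cs_snormE; have [] := X_cont u uT.
have fle u v e : lifespan T u -> lifespan T v ->
    (forall k, N k `^ s * `|X u k - X v k| <= e) -> f u <= f v + e.
  move=> uT vT uv; rewrite -lee_fin -fP//; apply/snorm_leP => k.
  have /snorm_leP/(_ k) vk : (snorm N s (X v) <= (f v)%:E)%E by rewrite fP.
  have -> : X u k = X v k + (X u k - X v k) by rewrite addrC subrK.
  have := ler_wpM2l (powR_ge0 (N k) s) (ler_normD (X v k) (X u k - X v k)).
  by have := uv k; lra.
have fc : {within `[0, t], continuous f}.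
  apply/subspace_continuousP => u ut; have uT := lifespan_itv t tT u ut.
  apply: cvg_trans (_ : f @ within (lifespan T) (nbhs u) --> f u).
    by apply: cvg_app; apply: within_subset; exact: lifespan_itv.
  apply/cvgrPdist_le => e e0; near=> v.
  have vT : lifespan T v by near: v; exact: withinT.
  have vu : forall k, N k `^ s * `|X v k - X u k| <= e.
    by near: v; exact: continuous_in_Cs_near.
  have uv k : N k `^ s * `|X u k - X v k| <= e by rewrite distrC.
  have := fle _ _ _ uT vT uv; have := fle _ _ _ vT uT vu.
  by rewrite ler_norml => ? ?; apply/andP; split; lra.
have [c _ cmax] := EVT_max t0 fc.
exists (f c) => u k ut; have uT := lifespan_itv t tT u ut.
have /snorm_leP/(_ k) : (snorm N s (X u) <= (f c)%:E)%E; last by [].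
by rewrite fP// lee_fin; apply: cmax.
Unshelve. all: by end_near. Qed.

End SolutionSpace.

(** * Lipschitz estimate and uniqueness in the weight N_k^alpha *)

Section Uniqueness.
Variables (R : realType) (N : nat -> R) (alpha : R).
Hypothesis alpha_gt0 : 0 < alpha.
Hypothesis N_gt0 : forall k, 0 < N k.
Hypothesis N_incr : forall k, N k `^ alpha <= N k.+1 `^ alpha.

Let lam k := N k `^ alpha.

(** The field loses nothing in C^alpha: it is quadratic, and of the two weights, one outside and one
    in the coefficient, each factor of a product absorbs one. In the square both factors sit at k+1,
    whence the use of [N_incr]. *)
Lemma obukhov_lip (x y : nat -> R) (M D : R) (k : nat) :
  (forall j, lam j * `|x j| <= M) -> (forall j, lam j * `|y j| <= M) ->
  (forall j, lam j * `|x j - y j| <= D) ->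
  lam k * `|obukhov N alpha x k - obukhov N alpha y k| <= 4 * M * D.
Proof.
move=> xM yM xyD.
have l0 j : 0 <= lam j by exact: powR_ge0.
have M0 : 0 <= M by apply: le_trans (xM 0%N); exact: mulr_ge0.
have D0 : 0 <= D by apply: le_trans (xyD 0%N); exact: mulr_ge0.
have prod (j : nat) : lam k * `|lam j * x j * x k - lam j * y j * y k| <= 2 * M * D.
  have -> : lam j * x j * x k - lam j * y j * y k =
    lam j * (x j * (x k - y k) + (x j - y j) * y k) by ring.
  rewrite normrM (ger0_norm (l0 j)).
  apply: (@le_trans _ _ (lam j * `|x j| * (lam k * `|x k - y k|) +
      lam j * `|x j - y j| * (lam k * `|y k|))).
    have := ler_wpM2l (mulr_ge0 (l0 k) (l0 j))
      (ler_normD (x j * (x k - y k)) ((x j - y j) * y k)).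
    by rewrite !normrM; lra.
  have p1 : lam j * `|x j| * (lam k * `|x k - y k|) <= M * D.
    by apply: ler_pM => //; exact: mulr_ge0.
  have p2 : lam j * `|x j - y j| * (lam k * `|y k|) <= D * M.
    by apply: ler_pM => //; exact: mulr_ge0.
  by lra.
have square : lam k * `|lam k * x k.+1 ^+ 2 - lam k * y k.+1 ^+ 2| <= 2 * M * D.
  rewrite -mulrBr subr_sqr !normrM (ger0_norm (l0 k)).
  apply: (@le_trans _ _ (lam k.+1 * `|x k.+1 - y k.+1| *
      (lam k.+1 * (`|x k.+1| + `|y k.+1|)))).
    move: (ler_normD (x k.+1) (y k.+1)) (N_incr k); rewrite -/(lam k) -/(lam k.+1).
    move=> xy ll; rewrite (_ : forall a b : R, lam k * (lam k * (a * b)) =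
      (lam k * a) * (lam k * b)); last by move=> a b; ring.
    apply: ler_pM; rewrite ?mulr_ge0//; first exact: ler_wpM2r.
    exact: ler_pM.
  rewrite (_ : 2 * M * D = D * (M + M)); last by ring.
  apply: ler_pM => //; first exact: mulr_ge0.
    by rewrite mulr_ge0// addr_ge0.
  by rewrite mulrDr lerD.
rewrite /obukhov; have := prod k.-1; case: k prod square => [|j] _ square /=.
  move=> _; rewrite !sub0r -opprD normrN -/(lam 0).
  by apply: le_trans square _; have := mulr_ge0 M0 D0; lra.
move=> prod; rewrite -/(lam j) -/(lam j.+1).
set a := lam j * x j * _; set a' := lam j * y j * _ in prod *.
set b := lam j.+1 * x _ ^+ 2 in square *; set b' := lam j.+1 * y _ ^+ 2 in square *.
have -> : a - b - (a' - b') = (a - a') - (b - b') by ring.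
by have := ler_wpM2l (l0 j.+1) (ler_normB (a - a') (b - b')); lra.
Qed.

(* Iterating the integrated equation in the time-weighted norm
   sup_t exp (- 8 M t) |.| halves any bound on the difference. *)
Lemma solution_unique (X0 : nat -> R) (T T' : \bar R) (X Y : R -> nat -> R) t :
  is_solution N alpha X0 T X -> is_solution N alpha X0 T' Y ->
  lifespan T t -> lifespan T' t -> X t = Y t.
Proof.
move=> [_ X0E Xc Xd _] [_ Y0E Yc Yd _] tT tT'.
have [t0 tTlt] := tT; have [_ tTlt'] := tT'.
have [MX XM] := continuous_in_Cs_bounded _ _ _ _ _ (Xc _ alpha_gt0) t tT.
have [MY YM] := continuous_in_Cs_bounded _ _ _ _ _ (Yc _ alpha_gt0) t tT'.
pose M := Num.max 1 (Num.max MX MY).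
have M1 : 1 <= M by rewrite le_max lexx.
have {}XM u k : 0 <= u <= t -> lam k * `|X u k| <= M.
  by move=> ut; apply: le_trans (XM u k ut) _; rewrite !le_max lexx orbT.
have {}YM u k : 0 <= u <= t -> lam k * `|Y u k| <= M.
  by move=> ut; apply: le_trans (YM u k ut) _; rewrite !le_max lexx !orbT.
have l0 j : 0 < lam j by exact: powR_gt0.
have dist n u k : 0 <= u <= t ->
    lam k * `|X u k - Y u k| <= 2 * M * (1 / 2) ^+ n * expR (8 * M * u).
  elim: n u k => [|n IH] u k /andP[u0 ut].
    have uin : 0 <= u <= t by rewrite u0.
    have e1 : 1 <= expR (8 * M * u).
      by apply: le_trans (expR_ge1Dx _); rewrite lerDl !mulr_ge0//; lra.
    apply: (@le_trans _ _ (2 * M)); last by rewrite expr0 mulr1 ler_peMr//; lra.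
    have := ler_wpM2l (ltW (l0 k)) (ler_normB (X u k) (Y u k)).
    by have := XM u k uin; have := YM u k uin; lra.
  (* With D = 2 M 2^-n exp (8 M v), the Lipschitz bound 4 M D equals lam_k (8 M) A exp (8 M v). The
     new bound lam_k A = M 2^-n is half of the old 2 M 2^-n. *)
  pose A := M * (1 / 2) ^+ n / lam k.
  have A0 : 0 <= A.
    apply: divr_ge0 (ltW (l0 k)); apply: mulr_ge0; first lra.
    by apply: exprn_ge0; lra.
  have uT : lifespan T u.
    by split=> //; apply: le_lt_trans tTlt; rewrite lee_fin.
  have uT' : lifespan T' u.
    by split=> //; apply: le_lt_trans tTlt'; rewrite lee_fin.
  have inc : `|(X u k - Y u k) - (X 0 k - Y 0 k)| <= A * expR (8 * M * u).
    apply: (increment_exp _ (fun v => X v k - Y v k)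
      (fun v => obukhov N alpha (X v) k - obukhov N alpha (Y v) k)) => //.
    - move=> v /andP[v0 vu]; apply: is_deriveB.
        by apply: Xd => //; apply: lt_trans (_ : (u%:E < T)%E); case: uT.
      by apply: Yd => //; apply: lt_trans (_ : (u%:E < T')%E); case: uT'.
    - move=> v; apply: cvgB.
        exact: (continuous_in_Cs_itv _ _ N_gt0 _ _ _ (Xc _ alpha_gt0) u k uT).
      exact: (continuous_in_Cs_itv _ _ N_gt0 _ _ _ (Yc _ alpha_gt0) u k uT').
    - move=> v /andP[v0 vu].
      have vin : 0 <= v <= t by rewrite ltW//= (le_trans (ltW vu)).
      rewrite -(ler_pM2l (l0 k)).
      apply: le_trans (obukhov_lip (X v) (Y v) M _ k (fun j => XM v j vin)
        (fun j => YM v j vin) (fun j => IH v j vin)) _.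
      rewrite /A le_eqVlt; apply/orP; left; apply/eqP.
      by field; rewrite lt0r_neq0.
  rewrite X0E Y0E subrr subr0 in inc.
  have := ler_wpM2l (ltW (l0 k)) inc.
  rewrite /A (exprS _ n) => incA; apply: le_trans incA _.
  rewrite le_eqVlt; apply/orP; left; apply/eqP.
  by field; rewrite lt0r_neq0.
apply/funext => k; apply/eqP; rewrite -subr_eq0 -normr_le0.
rewrite -(pmulr_rle0 _ (l0 k)).
have tin : 0 <= t <= t by rewrite t0 lexx.
have lim : (2 * M * expR (8 * M * t)) * (1 / 2) ^+ n @[n --> \oo] --> (0 : R).
  rewrite -[0 in X in _ --> X](mulr0 (2 * M * expR (8 * M * t))).
  apply: cvgM; first exact: cvg_cst.
  by apply: cvg_expr; rewrite ger0_norm; lra.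
apply: (ler_cvg_to (cvg_cst _) lim); apply: nearW => n.
by have := dist n t k tin; rewrite [X in _ -> _ <= X]mulrAC.
Qed.

End Uniqueness.

(** * The blow-up solution *)

Section Frequencies.
Variables (R : realType) (alpha : R).
Hypothesis alpha_ge1 : 1 <= alpha.

(** The exponent b = 4 makes [rate k.+1] the fourth power of [rate k], and N_0 = 16 gives N_k >=
    2^(k+4), as [rough_lower] requires. The choice depends on neither [s] nor [alpha]. *)
Local Notation N := (freq (16 : R) 4).

Definition rate (k : nat) : R := N k `^ alpha.

Definition rough (k : nat) : R := (1 / 2) ^+ k.+1.

Lemma freqS k : N k.+1 = N k ^+ 4.
Proof. by rewrite /freq exprSr powRrM powR_mulrn// powR_ge0. Qed.

Lemma freq_ge k : 2 ^+ (k + 4) <= N k.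
Proof.
elim: k => [|k IH].
  by rewrite /freq expr0 powRr1//; lra.
rewrite freqS addSn exprS.
have t1 : 1 <= 2 ^+ (k + 4) :> R by rewrite exprn_ege1//; lra.
have t2 : 2 <= 2 ^+ (k + 4) :> R by rewrite addnS exprS ler_peMr// exprn_ege1//; lra.
apply: (@le_trans _ _ (N k * N k)).
  by apply: ler_pM; [lra | lra | exact: le_trans IH | exact: IH].
have n1 : 1 <= N k := le_trans t1 IH.
have : 1 <= N k * N k by rewrite mulr_ege1.
by rewrite !exprS expr0; move: (N k) n1 => x; nra.
Qed.

Lemma freq_ge1 k : 1 <= N k.
Proof. by apply: le_trans (freq_ge k); rewrite exprn_ege1//; lra. Qed.

Lemma freq_gt0 k : 0 < N k.
Proof. exact: lt_le_trans (freq_ge1 k). Qed.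

Lemma freq_ge16 k : 16 <= N k.
Proof.
apply: le_trans (freq_ge k); rewrite exprD.
have : 1 <= 2 ^+ k :> R by rewrite exprn_ege1//; lra.
by rewrite !exprS expr0; lra.
Qed.

Lemma freq_leS k : N k <= N k.+1.
Proof. by rewrite freqS exprS ler_peMr ?exprn_ege1 ?freq_ge1// ltW// freq_gt0. Qed.

Lemma freq_le_rate k : N k <= rate k.
Proof.
rewrite /rate -[leLHS]powRr1; last exact: ltW (freq_gt0 k).
by apply: ler_powR => //; exact: freq_ge1.
Qed.

Lemma rateS k : rate k.+1 = rate k ^+ 4.
Proof.
rewrite /rate freqS -powR_mulrn; last exact: ltW (freq_gt0 k).
rewrite -powRrM mulrC powRrM.
by rewrite powR_mulrn// powR_ge0.
Qed.

Lemma rate_ge16 k : 16 <= rate k.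
Proof. exact: le_trans (freq_ge16 k) (freq_le_rate k). Qed.

Lemma rate_ge1 k : 1 <= rate k.
Proof. by have := rate_ge16 k; lra. Qed.

Lemma rate_growth k : 4 * rate k <= rate k.+1.
Proof.
rewrite rateS exprS mulrC; apply: ler_wpM2l; first by have := rate_ge16 k; lra.
by rewrite !exprS expr0; have := rate_ge16 k; move: (rate k) => x; nra.
Qed.

Lemma rough_ge0 k : 0 <= rough k.
Proof. by rewrite exprn_ge0//; lra. Qed.

Lemma rough_gt0 k : 0 < rough k.
Proof. by rewrite exprn_gt0//; lra. Qed.

(** As [rate k.+1] is a fourth power, this reduces to 2^(k+4) <= lam_k^2, and 2^(k+4) <= N_k <=
    lam_k. *)
Lemma rough_lower k : 4 * rate k ^+ 2 <= rate k.+1 * rough k.+1.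
Proof.
rewrite rateS /rough div1r exprVn ler_pdivlMr ?exprn_gt0//.
have : 4 * 2 ^+ k.+2 <= rate k ^+ 2.
  apply: (@le_trans _ _ (2 ^+ (k + 4))).
    by rewrite !addnS addn0 !exprS; have := exprn_ge0 k (ler0n R 2); lra.
  apply: (le_trans (freq_ge k)); apply: le_trans (freq_le_rate k) _.
  by rewrite expr2 ler_peMr// ?rate_ge1//; have := rate_ge1 k; lra.
move=> /(ler_wpM2l (sqr_ge0 (rate k))).
by rewrite !(exprS (rate k)) expr0; lra.
Qed.

Lemma rough_energy m : \sum_(0 <= i < m) rough i ^+ 2 <= 1 / 2.
Proof.
suff : \sum_(0 <= i < m) rough i ^+ 2 <= 1 / 2 * (1 - (1 / 4) ^+ m).
  by have : 0 <= (1 / 4 : R) ^+ m by [apply: exprn_ge0; lra]; lra.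
elim: m => [|m IH]; first by rewrite big_geq// expr0 subrr mulr0.
rewrite big_nat_recr//= (exprS _ m) /rough -exprM mulnC exprM.
rewrite (_ : (1 / 2) ^+ 2 = 1 / 4 :> R); last by field.
rewrite (exprS _ m); have : 0 <= (1 / 4 : R) ^+ m by apply: exprn_ge0; lra.
by move: IH; lra.
Qed.

Lemma powR_le_expR (p : nat) : exists C : R, forall k, N k ^+ p * expR (- N k) <= C.
Proof.
exists (p.+1`!%:R) => k; have n1 := freq_ge1 k.
have f0 : 0 < p.+1`!%:R :> R by rewrite ltr0n fact_gt0.
have := expR_ge1Dxn p (ltW (freq_gt0 k)); rewrite expRN ler_pdivrMr ?expR_gt0// => h.
have : N k ^+ p.+1 / p.+1`!%:R <= expR (N k) by lra.
rewrite ler_pdivrMr// mulrC; apply: le_trans.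
by rewrite exprS ler_peMl// exprn_ge0// ltW// freq_gt0.
Qed.

Lemma freq_powR_le (a b : R) k : a <= b -> N k `^ a <= N k `^ b.
Proof. by move=> ab; apply: ler_powR => //; exact: freq_ge1. Qed.

(** By exp y >= 1 + y, N_k^s >= 4^k s ln 16, which outgrows the factor 2^-(k+1); then 2^k >= k
    suffices. *)
Lemma rough_unbounded (s A : R) : 0 < s -> exists k, A < N k `^ s * rough k.
Proof.
move=> s0; pose d := s * ln (16 : R).
have d0 : 0 < d by rewrite mulr_gt0// ln_gt0//; lra.
pose k := (Num.truncn (`|A| * 2 / d)).+1; exists k.
have kA : `|A| * 2 / d < k%:R by exact: truncnS_gt.
have Nk : 4 ^+ k * d <= N k `^ s.
  rewrite /freq -powRrM /powR ifF; last by apply/negbTE; rewrite lt0r_neq0.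
  apply: le_trans (_ : 1 + 4 ^+ k * s * ln 16 <= _); last exact: expR_ge1Dx.
  by rewrite /d mulrA lerDr.
apply: lt_le_trans (ler_wpM2r (rough_ge0 k) Nk).
have -> : 4 ^+ k * d * rough k = 2 ^+ k * (d / 2).
  rewrite (_ : 2 = 4 * (1 / 2) :> R); last by field.
  rewrite exprMn /rough (exprS _ k); move: (4 ^+ k) ((1 / 2) ^+ k) => u v.
  by field.
have k2 : k%:R <= 2 ^+ k :> R by rewrite -natrX ler_nat ltnW// ltn_expl.
apply: le_lt_trans (ler_norm A) _.
rewrite ltr_pdivrMr// in kA.
have := ler_wpM2r (ltW d0) k2; lra.
Qed.

End Frequencies.

(** * Regularity for positive backward time, and time reversal *)

Section TimeReversal.
Variables (R : realType) (alpha : R).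
Hypothesis alpha_ge1 : 1 <= alpha.

Local Notation N := (freq (16 : R) 4).
Local Notation lam := (rate R alpha).
Local Notation F := (bfield R lam).

Variable x : R -> nat -> R.
Hypothesis x01 : forall t k, 0 <= t <= 2 -> 0 <= x t k <= 1.
Hypothesis x_lower : forall t k, 0 <= t <= 2 ->
  rough R k * expR (- (2 * mu R lam k * t)) <= x t k.
Hypothesis x_decay : forall t k, 0 <= t <= 2 -> 1 / 2 <= t * lam k ->
  x t k.+2 ^+ 2 <= 2 * expR (- lam k).
Hypothesis x_taylor : forall s t k, 0 <= s -> s <= t -> t <= 2 ->
  `|x t k - x s k| <= (t - s) * speed R lam k /\
  `|x t k - x s k - (t - s) * F (x s) k| <= accel R lam k * (t - s) ^+ 2.

Let lam1 k : 1 <= lam k := rate_ge1 R alpha alpha_ge1 k.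

Lemma mu_le_rate k : mu R lam k <= lam k.
Proof.
case: k => [|k] /=; first exact: lam_ge0.
by have := rate_growth R alpha alpha_ge1 k; have := lam1 k; lra.
Qed.

(** [x_taylor] expands at the earlier time only. For t < s one expands at t and trades F(x t) for
    F(x s), at the price of a second [accel] term. *)
Lemma taylor2 s t k : 0 <= s <= 2 -> 0 <= t <= 2 ->
  `|x t k - x s k - (t - s) * F (x s) k| <= 2 * accel R lam k * (t - s) ^+ 2.
Proof.
move=> s02 t02; have /andP[s0 s2] := s02; have /andP[t0 t2] := t02.
have a0 := accel_ge0 R lam lam1 k; have sq := sqr_ge0 (t - s).
have [st|/ltW ts] := leP s t.
  by have [_] := x_taylor s t k s0 st t2; have := mulr_ge0 a0 sq; lra.
have [_ T] := x_taylor t s k t0 ts s2.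
have dF := bfield_lip R lam lam1 (x s) (x t) k (s - t) (fun i => x01 s i s02)
  (fun i => x01 t i t02) (fun i => (x_taylor t s i t0 ts s2).1).
have -> : x t k - x s k - (t - s) * F (x s) k =
  - (x s k - x t k - (s - t) * F (x t) k) + (s - t) * (F (x s) k - F (x t) k).
  by ring.
apply: le_trans (ler_normD _ _) _; rewrite normrN normrM.
have st0 : 0 <= s - t by rewrite subr_ge0.
rewrite (ger0_norm st0); have := ler_wpM2l st0 dF; move: T.
rewrite -[(t - s) ^+ 2]sqrrN opprB; lra.
Qed.

(** From time [delta] on, all but finitely many modes satisfy x_{k+2}^2 <= 2 exp (- lam_k), and this
    beats any power of N_{k+2} = N_k^16. The remaining modes enter through the finite sum [S]. *)
Lemma regular (sigma delta : R) : 0 < delta -> exists C : R,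
  0 <= C /\ forall k t, delta <= t <= 2 -> N k `^ sigma * x t k <= C.
Proof.
move=> d0; pose p := (Num.truncn `|sigma|).+1.
have sp : sigma <= p%:R by apply: le_trans (ler_norm _) (ltW (truncnS_gt _)).
(* 32 = 16 * 2: the decay is known two modes lower and for the square. *)
have [C0 C0P] := powR_le_expR R (32 * p).
have C00 : 0 <= C0.
  apply: le_trans (C0P 0%N); rewrite mulr_ge0 ?expR_ge0//.
  by rewrite exprn_ge0// ltW// freq_gt0.
(* For k >= K, lam_k >= 2^(k+4) > k >= 1 / delta, so t lam_k >= 1 for all t >= delta. *)
pose K := (Num.truncn delta^-1).+1.
pose S := \sum_(0 <= i < K.+2) N i `^ sigma.
have S0 : 0 <= S by apply: sumr_ge0 => i _; exact: powR_ge0.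
exists (1 + 2 * C0 + S); split; first lra.
move=> k t /andP[dt t2].
have t02 : 0 <= t <= 2 by rewrite t2 andbT; apply: le_trans dt; exact: ltW.
have [kK|] := ltnP k K.+2.
  have : N k `^ sigma <= S.
    rewrite /S big_mkord (bigD1 (Ordinal kK)) //= lerDl.
    by apply: sumr_ge0 => i _; exact: powR_ge0.
  have /andP[x0 x1] := x01 t k t02; have := powR_ge0 (N k) sigma.
  by move: (N k `^ sigma) => w; nra.
case: k => [|[|k]] // Kk; rewrite !ltnS in Kk.
have n1 := freq_ge1 R k; have nl := freq_le_rate R alpha alpha_ge1 k.
have tk : 1 / 2 <= t * lam k.
  have : delta^-1 <= lam k.
    apply: le_trans nl; apply: le_trans (freq_ge R k).
    apply: le_trans (ltW (truncnS_gt _)) _; rewrite -natrX ler_nat -/K.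
    apply: leq_trans Kk _; apply: leq_trans (leq_addr 4 k) _.
    by rewrite ltnW// ltn_expl.
  have t0 : 0 <= t by case/andP: t02.
  move=> /(ler_wpM2l t0); apply: le_trans.
  apply: le_trans (_ : 1 <= _); first lra.
  by rewrite ler_pdivlMr// mul1r.
have xd := x_decay t k t02 tk.
have /andP[x0 _] := x01 t k.+2 t02.
apply: (@le_trans _ _ (N k.+2 ^+ p * x t k.+2)).
  apply: ler_wpM2r => //; rewrite -powR_mulrn; last exact: ltW (freq_gt0 R _).
  exact: freq_powR_le.
set u := N k.+2 ^+ p * x t k.+2.
have : u ^+ 2 <= 2 * C0.
  have NE : (N k.+2 ^+ p) ^+ 2 = N k ^+ (32 * p).
    by rewrite !freqS -3!exprM; congr (_ ^+ _); rewrite !mulnA mulnAC.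
  rewrite /u exprMn NE.
  apply: le_trans (_ : N k ^+ (32 * p) * (2 * expR (- N k)) <= _).
    apply: ler_wpM2l; first by rewrite exprn_ge0//; lra.
    by apply: le_trans xd _; rewrite ler_pM2l// ler_expR lerN2.
  by have := C0P k; lra.
(* From u <= 1 + u^2. *)
by nra.
Qed.

Lemma field_regular (sigma delta : R) : 0 <= sigma -> 0 < delta ->
  exists C : R, 0 <= C /\
    forall k t, delta <= t <= 2 -> N k `^ sigma * `|F (x t) k| <= C.
Proof.
move=> s0 d0; have [C [C0 CP]] := regular (sigma + alpha) delta d0.
exists (2 * C); split; first lra.
move=> k t dt.
have t02 : 0 <= t <= 2.
  by move/andP: dt => [dt ->]; rewrite andbT; apply: le_trans dt; exact: ltW.
have wE : N k `^ sigma * lam k = N k `^ (sigma + alpha).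
  rewrite powRD//; apply/implyP => _; rewrite lt0r_neq0//; exact: freq_gt0.
have w0 := powR_ge0 (N k) sigma.
have /andP[a0 a1] := x01 t k t02; have /andP[b0 b1] := x01 t k.+1 t02.
have /andP[e0 e1] := x01 t k.-1 t02.
have p1 : N k `^ sigma * (lam k * x t k.+1 ^+ 2) <= C.
  rewrite mulrA wE; apply: le_trans (CP k.+1 t dt).
  apply: ler_pM; [exact: powR_ge0 | exact: sqr_ge0 | | ].
    apply: ge0_ler_powR; rewrite ?nnegrE; 
      [exact: addr_ge0 s0 (le_trans ler01 alpha_ge1) | | | exact: freq_leS];
      exact: ltW (freq_gt0 R _).
  by rewrite expr2 ler_piMl.
have p2 : N k `^ sigma * (mu R lam k * x t k.-1 * x t k) <= C.
  apply: le_trans (CP k t dt); rewrite -wE -[leRHS]mulrA; apply: ler_wpM2l => //.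
  have m0 := mu_ge0 R lam lam1 k; have ml := mu_le_rate k.
  rewrite -[leLHS]mulrA; apply: ler_pM => //; first exact: mulr_ge0.
  by rewrite ler_piMl.
rewrite /bfield.
have := ler_wpM2l w0 (ler_normB (lam k * x t k.+1 ^+ 2) (mu R lam k * x t k.-1 * x t k)).
rewrite (ger0_norm (_ : 0 <= lam k * _)); last first.
  by rewrite mulr_ge0 ?sqr_ge0// lam_ge0.
rewrite (ger0_norm (_ : 0 <= mu R lam k * _ * _)); last first.
  by rewrite !mulr_ge0// mu_ge0.
by lra.
Qed.

Lemma backward_derive (t : R) (k : nat) : 0 < t < 2 -> is_derive t 1 (x ^~ k) (F (x t) k).
Proof.
move=> /andP[t0 t2].
apply: (@taylor_is_derive _ _ _ _ (2 * accel R lam k) (Num.min t (2 - t))).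
  by rewrite lt_min t0 subr_gt0.
move=> u; rewrite lt_min !ltr_norml => /andP[/andP[u1 u2] /andP[u3 u4]].
have := taylor2 t (t + u) k; rewrite [t + u - t]addrC addKr.
by apply; apply/andP; split; lra.
Qed.

Definition forward (t : R) : nat -> R := x (1 - t).

Lemma obukhov_bfield y k : obukhov N alpha y k = - F y k.
Proof. by case: k => [|k]; rewrite /obukhov /bfield /= /rate; ring. Qed.

Lemma forward_taylor t k u : 0 <= 1 - t <= 2 -> 0 <= 1 - (t + u) <= 2 ->
  `|forward (t + u) k - forward t k - u * obukhov N alpha (forward t) k| <=
    2 * accel R lam k * u ^+ 2.
Proof.
move=> t02 u02; have := taylor2 (1 - t) (1 - (t + u)) k t02 u02.
rewrite obukhov_bfield /forward.
rewrite (_ : 1 - (t + u) - (1 - t) = - u); last by ring.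
by rewrite mulNr mulrN sqrrN.
Qed.

Lemma lifespan1 (t : R) : lifespan 1%:E t -> 0 <= t < 1.
Proof. by move=> [t0]; rewrite lte_fin => t1; rewrite t0. Qed.

Lemma forward_Cs (t sigma : R) : 0 <= t < 1 -> Cs N sigma (forward t).
Proof.
move=> /andP[t0 t1]; have d0 : 0 < 1 - t by rewrite subr_gt0.
have [C [C0 CP]] := regular sigma (1 - t) d0.
apply: le_lt_trans (ltry C); apply/snorm_leP => k.
have t02 : 0 <= 1 - t <= 2 by apply/andP; split; lra.
have /andP[y0 _] := x01 (1 - t) k t02.
by rewrite /forward ger0_norm//; apply: CP; apply/andP; split; lra.
Qed.

(** The mean value inequality holds mode by mode, with the weighted derivative bounded uniformly in
    the mode by [field_regular]. *)
Lemma forward_lipschitz (sigma t0 : R) : 0 <= sigma -> t0 < 1 -> exists C : R,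
  forall t u, 0 <= t <= t0 -> 0 <= u <= t0 ->
    (snorm N sigma (forward u \- forward t)%R <= (C * `|u - t|)%:E)%E.
Proof.
move=> s0 t1; have d0 : 0 < 1 - t0 by rewrite subr_gt0.
have [C [C0 CP]] := field_regular sigma (1 - t0) s0 d0.
have inc a b k : 1 - t0 <= a -> a <= b -> b <= 1 ->
    N k `^ sigma * `|x b k - x a k| <= C * (b - a).
  move=> ta ab b1; have w0 : 0 < N k `^ sigma by rewrite powR_gt0// freq_gt0.
  rewrite mulrC -ler_pdivlMr// mulrAC.
  apply: (increment_le _ (x ^~ k) (fun v => F (x v) k)) => //.
  - move=> v /andP[av vb]; apply: backward_derive; apply/andP; split; lra.
  - apply: derivable_within_continuous => v; rewrite in_itv /= => /andP[av vb].
    by have [] := backward_derive v k ltac:(apply/andP; split; lra).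
  - move=> v /andP[av vb]; rewrite ler_pdivlMr// mulrC; apply: CP.
    by apply/andP; split; lra.
exists C => t u /andP[ta tb] /andP[ua ub]; apply/snorm_leP => k /=.
rewrite /forward; have [ut|/ltW tu] := leP u t.
  rewrite (ler0_norm (_ : u - t <= 0)) ?subr_le0// (_ : - (u - t) = 1 - u - (1 - t)); last by ring.
  by apply: inc; lra.
rewrite distrC (ger0_norm (_ : 0 <= u - t)) ?subr_ge0// (_ : u - t = 1 - t - (1 - u)); last by ring.
by apply: inc; lra.
Qed.

Lemma forward_continuous sigma : 0 < sigma -> continuous_in_Cs N sigma 1%:E forward.
Proof.
move=> s0 t tT; have t01 := lifespan1 t tT; have /andP[t0 t1] := t01.
split; first exact: forward_Cs.
(* The midpoint of t and 1 leaves room around t while keeping away from the blow-up time. *)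
have m1 : (1 + t) / 2 < 1 by lra.
have [C CP] := forward_lipschitz sigma ((1 + t) / 2) (ltW s0) m1.
apply: (@squeeze_cvge _ _ _ _ (fun=> 0%E) _ (fun u => (C * `|u - t|)%:E)).
- have e0 : 0 < (1 - t) / 2 by lra.
  near=> u; rewrite snorm_ge0 /=.
  have uT : lifespan 1%:E u by near: u; exact: withinT.
  have ut : `|t - u| < (1 - t) / 2.
    near: u; apply: (filterS _ (nbhsx_ballx t _ e0)) => v tv _; exact: tv.
  move: ut; rewrite ltr_norml => /andP[u1 u2].
  have /andP[u0 _] := lifespan1 u uT.
  by apply: CP; apply/andP; split; lra.
- exact: cvg_cst.
- apply: cvg_within_filter; apply: cvg_EFin; first by apply: nearW.
  rewrite -[0](mulr0 C); apply: cvgM; first exact: cvg_cst.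
  by rewrite -(normr0 R) -(subrr t); apply: cvg_norm; apply: cvgB => //; exact: cvg_cst.
Unshelve. all: by end_near. Qed.

Lemma forward_solution : is_solution N alpha (forward 0) 1%:E forward.
Proof.
split => //.
- exact: forward_continuous.
- move=> k t t0; rewrite lte_fin => t1.
  apply: (@taylor_is_derive _ _ _ _ (2 * accel R lam k) (Num.min t (1 - t))).
    by rewrite lt_min t0 subr_gt0.
  move=> u; rewrite lt_min !ltr_norml => /andP[/andP[u1 u2] /andP[u3 u4]].
  by apply: forward_taylor; apply/andP; split; lra.
(* As x extends to backward time 2, [forward] extends to negative times, and the right derivative at
   0 follows from a two-sided one. *)
- move=> k; apply: cvg_dnbhs_at_right.
  have T u : `|u| < 1 ->
      `|forward (0 + u) k - forward 0 k - u * obukhov N alpha (forward 0) k| <=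
      2 * accel R lam k * u ^+ 2.
    by rewrite ltr_norml => /andP[u1 u2]; apply: forward_taylor; apply/andP; split; lra.
  apply: cvg_trans (taylor_derivable _ (forward ^~ k) 0 _ _ _ ltr01 T).
  by apply: near_eq_cvg; apply: nearW => h /=; rewrite add0r.
Qed.

Lemma forward_gt0 k : 0 < forward 0 k.
Proof.
rewrite /forward subr0; apply: lt_le_trans (x_lower 1 k _); last by lra.
by rewrite mulr_gt0 ?rough_gt0 ?expR_gt0.
Qed.

(** At time 1 / lam_k before blow-up, mode k is at least exp (-2) 2^-(k+1), because mu_k <= lam_k;
    [rough_unbounded] then picks k. *)
Lemma forward_unbounded (s A : R) : 0 < s ->
  exists t k, 0 <= t < 1 /\ A < N k `^ s * forward t k.
Proof.
move=> s0; have [k kA] := rough_unbounded R s (A * expR 2) s0.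
have l1 := lam1 k; have l0 : 0 < lam k by lra.
have i1 : (lam k)^-1 <= 1 by rewrite invf_le1.
have i0 : 0 < (lam k)^-1 by rewrite invr_gt0.
exists (1 - (lam k)^-1), k; split; first by apply/andP; split; lra.
rewrite /forward subKr.
have t02 : 0 <= (lam k)^-1 <= 2 by apply/andP; split; lra.
apply: lt_le_trans (ler_wpM2l (powR_ge0 _ _) (x_lower _ k t02)).
have e2 : expR (- 2) <= expR (- (2 * mu R lam k * (lam k)^-1)).
  rewrite ler_expR lerN2 ler_pdivrMr//.
  by have := mu_le_rate k; lra.
have w0 : 0 <= N k `^ s * rough R k by rewrite mulr_ge0 ?powR_ge0 ?rough_ge0.
rewrite mulrA; apply: lt_le_trans (ler_wpM2l w0 e2).
by rewrite expRN ltr_pdivlMr ?expR_gt0.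
Qed.

End TimeReversal.

(** * Blow-up at time 1 and maximality *)

Theorem theorem1p8 (R : realType) (alpha : R) (halpha : 1 <= alpha)
    (s : R) (hs : 0 < s) :
  exists N0 b : R, 1 < N0 /\ 1 < b /\
  exists X0 : nat -> R,
    Coo (freq N0 b) X0 /\ (forall k : nat, 0 < X0 k) /\
    exists (Tstar : \bar R) (X : R -> nat -> R),
      is_maximal_solution (freq N0 b) alpha X0 Tstar X /\
      (Tstar < +oo)%E /\
      ereal_sup [set snorm (freq N0 b) s (X t) | t in lifespan Tstar] = +oo%E.
Proof.
have [x [x01 xlow xdec xtay]] := backward_solution R (rate R alpha) (rough R)
  (rate_ge1 R alpha halpha) (rough_ge0 R) (rough_energy R)
  (rate_growth R alpha halpha) (rough_lower R alpha halpha).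
have sol := forward_solution R alpha halpha x x01 xdec xtay.
have unb := forward_unbounded R alpha halpha x xlow s.
exists 16, 4; split; first lra; split; first lra.
exists (forward R x 0); split.
  by move=> sigma _; apply: (forward_Cs R alpha halpha x x01 xdec); rewrite lexx ltr01.
split; first exact: (forward_gt0 R alpha).
have n0 := freq_gt0 R.
have incr k : freq 16 4 k `^ alpha <= freq 16 4 k.+1 `^ alpha.
  by have := rate_growth R alpha halpha k; have := rate_ge1 R alpha halpha k; rewrite /rate; lra.
exists 1%:E, (forward R x); split; last first.
  split; first exact: ltry.
  apply/eqyP => A _; have [t [k [/andP[t0 t1] At]]] := unb A hs.
  apply: le_trans (_ : (snorm (freq 16 4) s (forward R x t) <= _)%E); last first.
    by apply: ereal_sup_ubound; exists t => //; split.
  apply: le_trans (_ : ((freq 16 4 k `^ s * `|forward R x t k|)%:E <= _)%E).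
    rewrite lee_fin; apply: le_trans (ltW At) _.
    by rewrite ler_wpM2l ?powR_ge0// ler_norm.
  by apply: ereal_sup_ubound; exists k.
split=> // T' Y solY.
have eqY t : lifespan T' t -> lifespan 1%:E t -> Y t = forward R x t.
  exact: (solution_unique R _ alpha (lt_le_trans ltr01 halpha) n0 incr _ _ _ _ _ t
    solY sol).
(* A solution living beyond time 1 would be bounded in C^s on [0, 1], yet it agrees with [forward]
   on [0, 1), where the weighted modes are unbounded. *)
have T'1 : (T' <= 1%:E)%E.
  rewrite leNgt; apply/negP => T'1.
  have [_ _ Yc _ _] := solY.
  have oneT' : lifespan T' 1 by split.
  have [M YM] := continuous_in_Cs_bounded _ _ _ _ _ (Yc s hs) 1 oneT'.
  have [t [k [t01 Mlt]]] := unb M hs.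
  have /andP[t0 t1] := t01.
  have tT : lifespan 1%:E t by split.
  have tT' : lifespan T' t by apply: (lifespan_itv _ _ _ oneT'); rewrite /= in_itv /= t0 ltW.
  have tin : 0 <= t <= 1 by rewrite t0 ltW.
  have := YM t k tin; rewrite (eqY t tT' tT); apply/negP; rewrite -ltNge.
  by apply: lt_le_trans Mlt _; rewrite ler_wpM2l ?powR_ge0// ler_norm.
split => // t tT'; apply: eqY => //; have [t0 tlt] := tT'; split => //.
exact: lt_le_trans T'1.
Qed.
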